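(* Let $I$ be a compact interval of $\mathbb{R}$ and let $Y$ be the LMSM with Hurst functional parameter $H(\cdot)$. Assume that $(\mathbf{A'})$: $H(I)\subset(1/\alpha;1)$ and $H(\cdot)\in\mathcal{C}^{\gamma_H}(I)$ for some $\gamma_H\in[0,1)$. Then for every $\omega\in\Omega_0^*\cap\Omega_1^*$ (an event of probability $1$), $$\sup_{(t,s)\in I^2,\ t\neq s}\left\{\frac{|Y(t,\omega)-Y(s,\omega)|}{|t-s|^{\gamma_H\wedge\left(\min_{x\in I}H(x)-1/\alpha\right)}}\right\}<\infty .$$
   Context: Fix $\alpha\in(1,2)$. Let $Z_\alpha(ds)$ be an independently scattered symmetric $\alpha$-stable random measure on $\mathbb{R}$ with Lebesgue control measure, defined on a probability space $(\Omega,\mathcal{F},\mathbb{P})$. For $x\in\mathbb{R}$, $\kappa\in\mathbb{R}$, $(x)_+^\kappa=x^\kappa$ if $x>0$ and $0$ otherwise. Let $\psi$ be a three times continuously differentiable compactly supported Daubechies mother wavelet generating an orthonormal basis of $L^2(\mathbb{R})$. For $(x,v)\in\mathbb{R}\times(1/\alpha;1)$ put $\Psi(x,v)=\int_{\mathbb{R}}(x-s)_+^{v-1/\alpha}\psi(s)\,ds$, and for $(j,k)\in\mathbb{Z}^2$ put $\epsilon_{j,k}=2^{j/\alpha}\int_{\mathbb{R}}\psi(2^js-k)\,Z_\alpha(ds)$. $\Omega_0^*$ denotes an event of probability $1$ such that for every real $\eta>0$ there is a positive finite random variable $C_\eta$ with $|\epsilon_{j,k}(\omega)|\le C_\eta(\omega)(3+|j|)^{1/\alpha+\eta}(3+|k|)^{1/\alpha+\eta}$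 for all $\omega\in\Omega_0^*$ and all $(j,k)\in\mathbb{Z}^2$ (such an event exists). $\Omega_1^*$ denotes an event of probability $1$ such that for every real $l>0$ there is a positive finite random variable $C'_l$ with $|\epsilon_{j,k}(\omega)|\le C'_l(\omega)2^{j/\alpha}$ for all $\omega\in\Omega_1^*$ and all $(j,k)\in\mathbb{Z}_+\times\mathbb{Z}$ with $|k|2^{-j}\le l$ (such an event exists). The field $X=\{X(u,v):(u,v)\in\mathbb{R}\times(1/\alpha;1)\}$, $X(u,v)=\int_{\mathbb{R}}\{(u-s)_+^{v-1/\alpha}-(-s)_+^{v-1/\alpha}\}Z_\alpha(ds)$, is identified with its modification given on $\Omega_0^*$ by the series $X(u,v)=\sum_{(j,k)\in\mathbb{Z}^2}2^{-jv}\epsilon_{j,k}\big(\Psi(2^ju-k,v)-\Psi(-k,v)\big)$, which on $\Omega_0^*$ converges uniformly in $(u,v)$ on compact subsets of $\mathbb{R}\times(1/\alpha;1)$. Given a continuous function $H:\mathbb{R}\to(1/\alpha;1)$, the linear multifractional stable motion (LMSM) is $Y(t)=X(t,H(t))$, $t\in\mathbb{R}$. For a compact interval $I$ and $\gamma\in[0,1)$, $\mathcal{C}^\gamma(I)$ is the set of real continuous functions $f$ on $I$ with $\sup_{x\neq y\in I}|f(x)-f(y)|/|x-y|^\gamma<\infty$. $a\wedge b=\min(a,b)$. *)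

(* Defs.v *)
From HB Require Import structures.
From mathcomp Require Import all_boot all_order all_algebra.
From mathcomp Require Import all_classical all_reals all_analysis.
Set Implicit Arguments. Unset Strict Implicit. Unset Printing Implicit Defensive.
Import Order.TTheory GRing.Theory Num.Theory.
Import numFieldNormedType.Exports.
Local Open Scope classical_set_scope.
Local Open Scope ring_scope.

Definition pospow (R : realType) (x kappa : R) : R :=
  if 0 < x then x `^ kappa else 0.

Definition C3 (R : realType) (f : R -> R) : Prop :=
  (forall x, derivable f x 1) /\ (forall x, derivable (derive1 f) x 1) /\
  (forall x, derivable (derive1n 2 f) x 1) /\ continuous (derive1n 3 f).

Definition compact_support (R : realType) (f : R -> R) : Prop :=
  exists a b : R, forall x, ~ (x \in `[a, b]) -> f x = 0.

Definition wav (R : realType) (psi : R -> R) (j k : int) (x : R) : R :=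
  (2 : R) `^ (j%:~R / 2) * psi ((2 : R) `^ j%:~R * x - k%:~R).

Definition generates_ONB (R : realType) (psi : R -> R) : Prop :=
  (forall j k j' k' : int,
     lebesgue_measure.-integrable setT (fun x => (wav psi j k x * wav psi j' k' x)%:E)
     /\ \int[lebesgue_measure]_(x in setT) (wav psi j k x * wav psi j' k' x)
        = (if (j == j') && (k == k') then 1 else 0)) /\
  (forall f : R -> R, measurable_fun setT f ->
     lebesgue_measure.-integrable setT (fun x => (f x ^+ 2)%:E) ->
     (forall j k : int, \int[lebesgue_measure]_(x in setT) (f x * wav psi j k x) = 0) ->
     {ae lebesgue_measure, forall x, f x = 0}).

Definition Lalpha (R : realType) (alpha : R) (f : R -> R) : Prop :=
  measurable_fun setT f /\
  lebesgue_measure.-integrable setT (fun x => (`|f x| `^ alpha)%:E).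

(* IZ f = int_R f(s) Z_alpha(ds), for f in L^alpha, where Z_alpha is an
   independently scattered SalphaS random measure with Lebesgue control measure:
   IZ is a.s. linear on L^alpha and E[exp(i theta IZ f)] = exp(-|theta|^alpha ||f||_alpha^alpha)
   (these determine all finite-dimensional laws of {IZ f : f in L^alpha}). *)
Definition SaS_integral (R : realType) (d : measure_display) (Omega : measurableType d)
  (P : probability Omega R) (alpha : R) (IZ : (R -> R) -> Omega -> R) : Prop :=
  (forall f, Lalpha alpha f -> measurable_fun setT (IZ f)) /\
  (forall f g a b, Lalpha alpha f -> Lalpha alpha g ->
     {ae P, forall w, IZ (fun x => a * f x + b * g x) w = a * IZ f w + b * IZ g w}) /\
  (forall f, Lalpha alpha f -> forall theta : R,
     \int[P]_(w in setT) cos (theta * IZ f w)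
       = expR (- (`|theta| `^ alpha) * \int[lebesgue_measure]_(x in setT) (`|f x| `^ alpha))
     /\ \int[P]_(w in setT) sin (theta * IZ f w) = 0).

Definition Psi (R : realType) (alpha : R) (psi : R -> R) (x v : R) : R :=
  \int[lebesgue_measure]_(s in setT) (pospow (x - s) (v - alpha^-1) * psi s).

Definition eps (R : realType) (Omega : Type) (alpha : R) (psi : R -> R)
  (IZ : (R -> R) -> Omega -> R) (j k : int) (w : Omega) : R :=
  (2 : R) `^ (j%:~R / alpha) * IZ (fun s => psi ((2 : R) `^ j%:~R * s - k%:~R)) w.

Definition Xterm (R : realType) (Omega : Type) (alpha : R) (psi : R -> R)
  (IZ : (R -> R) -> Omega -> R) (u v : R) (w : Omega) (j k : int) : R :=
  (2 : R) `^ (- (j%:~R) * v) * eps alpha psi IZ j k w *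
  (Psi alpha psi ((2 : R) `^ j%:~R * u - k%:~R) v - Psi alpha psi (- k%:~R) v).

Definition Xpartial (R : realType) (Omega : Type) (alpha : R) (psi : R -> R)
  (IZ : (R -> R) -> Omega -> R) (u v : R) (w : Omega) (N : nat) : R :=
  \sum_(i < (N + N).+1) \sum_(l < (N + N).+1)
     Xterm alpha psi IZ u v w (i%:Z - N%:Z) (l%:Z - N%:Z).

(* X(u,v)(w) = sum_{(j,k) in Z^2} ...  (the modification given by the series) *)
Definition Xfield (R : realType) (Omega : Type) (alpha : R) (psi : R -> R)
  (IZ : (R -> R) -> Omega -> R) (u v : R) (w : Omega) : R :=
  limn (Xpartial alpha psi IZ u v w).

Definition LMSM (R : realType) (Omega : Type) (alpha : R) (psi : R -> R)
  (IZ : (R -> R) -> Omega -> R) (H : R -> R) (t : R) (w : Omega) : R :=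
  Xfield alpha psi IZ t (H t) w.

Definition Omega0_prop (R : realType) (d : measure_display) (Omega : measurableType d)
  (P : probability Omega R) (alpha : R) (e : int -> int -> Omega -> R) (O0 : set Omega) : Prop :=
  measurable O0 /\ P O0 = 1%E /\
  forall eta : R, 0 < eta -> exists C : Omega -> R,
    measurable_fun setT C /\ (forall w, 0 < C w) /\
    forall w, O0 w -> forall j k : int,
      `|e j k w| <= C w * (3 + `|j%:~R : R|) `^ (alpha^-1 + eta)
                        * (3 + `|k%:~R : R|) `^ (alpha^-1 + eta).

Definition Omega1_prop (R : realType) (d : measure_display) (Omega : measurableType d)
  (P : probability Omega R) (alpha : R) (e : int -> int -> Omega -> R) (O1 : set Omega) : Prop :=
  measurable O1 /\ P O1 = 1%E /\
  forall l : R, 0 < l -> exists C : Omega -> R,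
    measurable_fun setT C /\ (forall w, 0 < C w) /\
    forall w, O1 w -> forall j k : int, (0 <= j)%R ->
      `|k%:~R : R| * (2 : R) `^ (- (j%:~R)) <= l ->
      `|e j k w| <= C w * (2 : R) `^ (j%:~R / alpha).

Definition Holder_on (R : realType) (a b gamma : R) (f : R -> R) : Prop :=
  {within `[a, b], continuous f} /\
  exists c : R, forall x y, x \in `[a, b] -> y \in `[a, b] -> x != y ->
    `|f x - f y| <= c * `|x - y| `^ gamma.

(* Main.v *)
Require Import Defs.
From HB Require Import structures.
From mathcomp Require Import all_boot all_order all_algebra.
From mathcomp Require Import all_classical all_reals all_analysis.
From mathcomp Require Import ring lra.
Import Order.TTheory GRing.Theory Num.Theory.
Import numFieldNormedType.Exports.
Local Open Scope classical_set_scope.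
Local Open Scope ring_scope.
Set Implicit Arguments.
Unset Strict Implicit.

(** Vanishing moments of the wavelet make it a third derivative of a compactly supported
    function, so integrating by parts three times shows that [Psi], its increments in [x] and
    its increments in [v] decay like [(3 + |x|)^-2].  The difference [Y t - Y s] is split into
    the increment of [X] in time at the frozen exponent [H t] and the increment in the exponent
    at the frozen time [s]; the latter is Lipschitz in [|H t - H s|] by the bound defining
    [Omega_0].  For the former, write [h = |t - s|]: the terms with [j < 0], or with [|k|] large
    compared to [2^j], contribute [O(h)], and for the others the bound defining [Omega_1] leaves
    the sum over [j] of [2^(-j (v - 1/alpha)) min(1, 2^j h)], which is [O(h^(v - 1/alpha))]. *)

(** * Calculus *)

(** Vanishing moments are not assumed. They are extracted from orthogonality between scales: a very
    coarse copy of [psi], seen at the scale of a fine one, is nearly constant, and integration by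
    parts hands the same orthogonality on to a derivative of [psi] against a primitive. Three
    primitives are the right number because [alpha < 2] keeps the kernel exponent [v - 1/alpha]
    below 1/2, so that the third derivative of the kernel is [O(r^-2)]. Since [1/alpha < 1], square
    decay beats the growth [|k|^(1/alpha + eta)] of the coefficients and leaves a summable weight in
    [k]. The exponent to be reached allows no loss in the terms close to the interval. The loss
    [eta] in the first coefficient bound is affordable only where a strict margin exists: [1 - v]
    for negative [j], [v - 1/alpha] for distant [k] and for increments in the exponent. This is why
    constants must be uniform for [v] between the minimum and the maximum of [H]. All estimates
    bound finite sums of absolute values uniformly in [N]; convergence and bounds on limits then
    follow together. *)

Section Calculus.
Variable R : realType.
Implicit Types (f g F G : R -> R) (a b x y : R).
Local Notation mu := (@lebesgue_measure R).

Lemma is_derive_continuous f x l : is_derive x 1 f l -> {for x, continuous f}.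
Proof.
by case=> df _; apply: differentiable_continuous; apply/derivable1_diffP.
Qed.

Lemma continuous_on_within f a b :
  (forall x, a <= x <= b -> {for x, continuous f}) ->
  {within `[a, b], continuous f}.
Proof.
move=> cf; apply: continuous_in_subspaceT => x; rewrite inE /= in_itv /= => xab.
exact: cf.
Qed.

Lemma continuous_on_integrable f a b :
  (forall x, a <= x <= b -> {for x, continuous f}) ->
  mu.-integrable `[a, b] (EFin \o f).
Proof.
move=> /continuous_on_within cf; apply: continuous_compact_integrable => //.
exact: segment_compact.
Qed.

Lemma Rintegral_itv_bound f a b K : a <= b ->
  (forall x, a <= x <= b -> {for x, continuous f}) ->
  (forall x, a <= x <= b -> `|f x| <= K) ->
  `|\int[mu]_(x in `[a, b]) f x| <= K * (b - a).
Proof.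
move=> ab cf fK; apply: le_trans (le_normr_Rintegral _ _) _ => //.
  exact: continuous_on_integrable.
have -> : K * (b - a) = \int[mu]_(x in `[a, b]) (cst K x).
  rewrite Rintegral_cst //= lebesgue_measure_itv /= lte_fin.
  case: ltP => ba /=; first by [].
  have -> : a = b by apply/eqP; rewrite eq_le ab ba.
  by rewrite subrr.
apply: le_Rintegral => //.
- apply: (@continuous_on_integrable (fun x => `|f x|)) => x xab.
  by apply: (@continuous_comp _ _ _ f (@Num.norm _ _)); [exact: cf|exact: norm_continuous].
- by apply: continuous_on_integrable => x _; exact: cst_continuous.
Qed.

Lemma Rintegral_FTC2 F f a b : a < b ->
  (forall x, a <= x <= b -> is_derive x 1 F (f x)) ->
  (forall x, a <= x <= b -> {for x, continuous f}) ->
  \int[mu]_(x in `[a, b]) f x = F b - F a.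
Proof.
move=> ab dF cf; rewrite /Rintegral (@continuous_FTC2 R f F) //.
- exact: continuous_on_within.
- split.
  + by move=> x /[!in_itv] /= /andP[ax xb]; have [] := dF x; rewrite ?(ltW ax) ?(ltW xb).
  + by apply/cvg_at_right_filter/(@is_derive_continuous F a (f a))/dF; rewrite lexx ltW.
  + by apply/cvg_at_left_filter/(@is_derive_continuous F b (f b))/dF; rewrite lexx ltW.
- move=> x /[!in_itv] /= /andP[ax xb]; rewrite derive1E.
  by have [//|] := dF x; rewrite ?(ltW ax) ?(ltW xb).
Qed.

Lemma Rintegral_parts0 G g F f a b : a < b ->
  (forall x, a <= x <= b -> is_derive x 1 G (g x)) ->
  (forall x, a <= x <= b -> {for x, continuous g}) ->
  (forall x, a <= x <= b -> is_derive x 1 F (f x)) ->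
  (forall x, a <= x <= b -> {for x, continuous f}) ->
  F a = 0 -> F b = 0 ->
  \int[mu]_(x in `[a, b]) (G x * f x) = - \int[mu]_(x in `[a, b]) (g x * F x).
Proof.
move=> ab dG cg dF cf Fa Fb.
have cG x : a <= x <= b -> {for x, continuous G} by move=> /dG /is_derive_continuous.
have cF x : a <= x <= b -> {for x, continuous F} by move=> /dF /is_derive_continuous.
apply/eqP; rewrite -addr_eq0 -RintegralD //; first last.
- by apply: continuous_on_integrable => x xab; apply: continuousM; [exact: cg|exact: cF].
- by apply: continuous_on_integrable => x xab; apply: continuousM; [exact: cG|exact: cf].
suff -> : \int[mu]_(x in `[a, b]) (G x * f x + g x * F x) = G b * F b - G a * F a.
  by rewrite Fa Fb !mulr0 subr0.
apply: (@Rintegral_FTC2 (fun x => G x * F x)) => // x xab.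
- have dGx := dG _ xab; have dFx := dF _ xab.
  apply: is_derive_eq; rewrite /GRing.scale /=; ring.
- by apply: continuousD; apply: continuousM; [exact: cG|exact: cf|exact: cg|exact: cF].
Qed.

Lemma le_diff_MVT f df a b K : a <= b ->
  (forall x, a <= x <= b -> is_derive x 1 f (df x)) ->
  (forall x, a <= x <= b -> `|df x| <= K) ->
  `|f b - f a| <= K * (b - a).
Proof.
move=> ab dfx dfK.
have [||c] := @MVT_segment R f df a b ab.
- by move=> x /[!in_itv] /= /andP[ax xb]; apply: dfx; rewrite !ltW.
- by apply: continuous_on_within => x /dfx /is_derive_continuous.
- rewrite in_itv /= => cab ->.
  by rewrite normrM (ger0_norm (_ : 0 <= b - a)) ?subr_ge0 // ler_wpM2r ?subr_ge0 // dfK.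
Qed.

Lemma continuous_primitive f : continuous f ->
  exists F, forall x, is_derive x 1 F (f x).
Proof.
move=> cf.
have fi a b : mu.-integrable `[a, b] (EFin \o f).
  by apply: continuous_on_integrable => x _; exact: cf.
(* Starting at [-n] and subtracting the value at 0 avoids oriented integrals. The result does not
   depend on [n] once [-n] is to the left of 0 and [x]; taking [n = |x| + 2] below covers all points
   within distance 1 of [x]. *)
pose P n x := \int[mu]_(t in `[- n, x]) f t - \int[mu]_(t in `[- n, 0]) f t.
have Pnm (n m x : R) : 0 <= m -> m <= n -> - m <= x -> P n x = P m x.
  move=> m0 mn mx; rewrite /P.
  have mI u : - m <= u -> \int[mu]_(t in `[- n, u]) f t =
      \int[mu]_(t in `[- n, - m]) f t + \int[mu]_(t in `[- m, u]) f t.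
    move=> mu'; have := @Rintegral_itvB R f (BLeft (- n)) (BRight u) (- m) (fi _ _).
    rewrite !bnd_simp lerN2 => /(_ mn mu') E.
    rewrite -(@Rintegral_itv_obnd_cbnd R (- m)) -?E; first by rewrite addrC subrK.
    apply: integrableS (fi (- m) u) => //; exact: subset_itv_oc_cc.
  by rewrite mI // (mI 0) ?oppr_le0 // opprD addrACA subrr add0r.
exists (fun x => P (`|x| + 1) x) => x.
pose n : R := `|x| + 2.
apply: (@near_eq_is_derive _ _ _ (P n)).
  near=> y; apply: Pnm; first by rewrite addr_ge0.
    rewrite /n -lerBrDr -addrA.
    have -> : 2 - 1 = 1 :> R by ring.
    rewrite -lerBlDl; apply: le_trans (lerB_dist _ _) _; rewrite distrC.
    by near: y; exists 1 => //= z /= /ltW.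
  by have := ler_norm (- y); rewrite normrN; lra.
have nx : - n < x by rewrite /n; have := ler_norm (- x); rewrite normrN; lra.
have [d1 d2] : derivable (fun x => \int[mu]_(t in `[- n, x]) f t) x 1 /\
   derive1 (fun x => \int[mu]_(t in `[- n, x]) f t) x = f x.
  apply: (@continuous_FTC1 R f (BLeft (- n)) x (x + 1)); rewrite ?ltrDl //.
  exact: cf.
have d3 : is_derive x 1 (fun x => \int[mu]_(t in `[- n, x]) f t) (f x).
  by apply: DeriveDef; [exact: d1|rewrite -derive1E; exact: d2].
rewrite -[f x]subr0; exact: (is_deriveB d3 (is_derive_cst _ _ _)).
Unshelve. all: by end_near. Qed.

End Calculus.

(** * Vanishing moments *)

Section Moments.
Variable R : realType.
Implicit Types (f g F G th psi : R -> R) (a b x y A : R).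
Local Notation mu := (@lebesgue_measure R).

Definition supported A f := forall x, A <= `|x| -> f x = 0.

Lemma continuous_affine (f : R -> R) (h c : R) : continuous f ->
  continuous (fun y => f (h * (c + y))).
Proof.
move=> cf y; apply: (@continuous_comp _ _ _ (fun y => h * (c + y)) f); last exact: cf.
apply: continuousM; first exact: cst_continuous.
by apply: continuousD; [exact: cst_continuous|exact: cvg_id].
Qed.

Lemma is_derive_affine (f : R -> R) (h c y l : R) : is_derive (h * (c + y)) 1 f l ->
  is_derive y 1 (fun y => f (h * (c + y))) (h * l).
Proof.
move=> df.
have dg : is_derive y 1 (fun y => h * (c + y)) h.
  by apply: is_derive_eq; rewrite /GRing.scale /= ?(mulr0, mul0r, addr0, add0r, mulr1).
have := @is_derive1_comp R f (fun y => h * (c + y)) y l h df dg.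
by rewrite mulrC.
Qed.

Lemma segment_bounded f a b : continuous f ->
  exists2 K, 0 < K & forall x, a <= x <= b -> `|f x| <= K.
Proof.
move=> cf; have [ba|ab] := ltP b a.
  exists 1 => // x /andP[ax xb]; have := le_trans ax xb; by rewrite leNgt ba.
have [|c _ cmax] := @EVT_max R (fun x => `|f x|) a b ab.
- apply: continuous_on_within => x _.
  by apply: (@continuous_comp _ _ _ f (@Num.norm _ _)); [exact: cf|exact: norm_continuous].
- exists (`|f c| + 1) => [|x xab]; first by rewrite ltr_wpDl.
  by rewrite (le_trans (cmax x _)) ?in_itv // lerDl.
Qed.

Lemma eq_of_is_derive0 F f a b :
  (forall x, is_derive x 1 F (f x)) ->
  (forall x, Num.min a b <= x -> x <= Num.max a b -> f x = 0) -> F a = F b.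
Proof.
move=> dF; wlog ab : a b / a <= b => [wl|].
  case/orP: (le_total a b) => [|ba f0]; first exact: wl.
  by apply/esym/wl => // x; rewrite minC maxC; exact: f0.
rewrite min_l // max_r // => f0.
apply/eqP; rewrite eq_sym -subr_eq0 -normr_le0 -(mul0r (b - a)).
apply: (@le_diff_MVT R F f) => // x /andP[ax xb].
by rewrite f0 // normr0.
Qed.

Lemma derive_neq0 f g x y : (forall z : R, is_derive z 1 f (g z)) -> f x != f y ->
  exists z, g z != 0.
Proof.
move=> df; apply: contra_neqP => /forallNP g0.
by apply: (@eq_of_is_derive0 _ g) => // z _ _; have /negP/negPn/eqP := g0 z.
Qed.

Lemma half_expr_lt (e : R) : 0 < e -> exists2 j : nat, (0 < j)%N & 2^-1 ^+ j < e.
Proof.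
move=> e0; have i0 : 0 <= e^-1 by rewrite invr_ge0 ltW.
exists (Num.bound e^-1).+1 => //.
rewrite exprVn invf_plt ?posrE ?exprn_gt0 //.
apply: lt_trans (archi_boundP i0) _.
rewrite -natrX ltr_nat; apply: ltn_trans (ltnSn _) _; exact: ltn_expl.
Qed.

(* Shrinking the dyadic interval around a point [x] with [g x <> 0] gives [g x * \int th = 0]. *)
Lemma integral_eq0_of_dyadic_orthogonal g th A : 0 < A ->
  continuous g -> continuous th -> (exists x, g x != 0) ->
  (forall (j : nat) (k : int), (0 < j)%N ->
     \int[mu]_(y in `[- A, A]) (g (2^-1 ^+ j * (k%:~R + y)) * th y) = 0) ->
  \int[mu]_(y in `[- A, A]) th y = 0.
Proof.
move=> A0 cg cth [x gx0] orth.
have AA : - A <= A by lra.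
have [B B0 thB] := @segment_bounded th (- A) A cth.
set I := \int[mu]_(y in _) _.
suff: `|g x * I| <= 0 by rewrite normr_le0 mulf_eq0 (negbTE gx0) => /eqP.
apply/ler_addgt0Pl => e e0; rewrite addr0.
pose e' := e / (B * (A - - A)).
have BA : 0 < B * (A - - A) by rewrite mulr_gt0 //; lra.
have e'0 : 0 < e' by rewrite divr_gt0.
have /cvgrPdist_lt /(_ _ e'0) [/= d d0 dP] := cg x.
have [|j j0 jd] := @half_expr_lt (d / (1 + A)); first by rewrite divr_gt0 //; lra.
pose h : R := 2^-1 ^+ j; have h0 : 0 < h by rewrite exprn_gt0 // invr_gt0.
pose k := Num.floor (h^-1 * x).
have c1 : continuous (fun y => g (h * (k%:~R + y))) by exact: continuous_affine.
have -> : g x * I = \int[mu]_(y in `[- A, A]) ((g x - g (h * (k%:~R + y))) * th y).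
  under eq_Rintegral do rewrite mulrBl.
  rewrite RintegralB ?orth ?subr0 //.
  - rewrite RintegralZl //.
    by apply: continuous_on_integrable => y _; exact: cth.
  - apply: continuous_on_integrable => y _.
    by apply: continuousM; [exact: cst_continuous|exact: cth].
  - apply: continuous_on_integrable => y _.
    by apply: continuousM; [exact: c1|exact: cth].
have -> : e = e' * B * (A - - A) by rewrite -mulrA /e' divfK // gt_eqF.
apply: Rintegral_itv_bound => // y yA.
  apply: continuousM; last exact: cth.
  by apply: continuousB; [exact: cst_continuous|exact: c1].
rewrite normrM ler_pM //; last exact: thB.
apply/ltW/dP => /=.
have -> : x - h * (k%:~R + y) = h * ((h^-1 * x - k%:~R) - y).
  by rewrite !mulrBr mulrA mulfV ?gt_eqF // mul1r mulrDr; ring.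
rewrite normrM gtr0_norm //.
have : h < d / (1 + A) by [].
rewrite ltr_pdivlMr; last lra.
apply: le_lt_trans; rewrite ler_pM2l //.
apply: le_trans (ler_normB _ _) _.
apply: lerD; rewrite ler_norml; last exact: yA.
have := floor_le (h^-1 * x).
have := floorD1_gt (h^-1 * x); rewrite intrD -/k.
by move=> ? ?; apply/andP; lra.
Qed.

(** The primitive is normalised at [-A], so it vanishes on the left; the zero integral makes it
    vanish on the right too. The support window stays the same for the next round. *)
Lemma supported_primitive th A : 0 < A -> continuous th -> supported A th ->
  \int[mu]_(y in `[- A, A]) th y = 0 ->
  exists2 F, (forall x, is_derive x 1 F (th x)) & supported A F.
Proof.
move=> A0 cth sth i0; have [F dF] := @continuous_primitive R th cth.
have FA : F A = F (- A).
  apply/eqP; rewrite -subr_eq0; apply/eqP; rewrite -{}[RHS]i0.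
  have AA : - A < A by lra.
  by apply/esym/(@Rintegral_FTC2 R F) => // x _; exact: cth.
exists (fun x => F x - F (- A)) => x.
  have dFx := dF x.
  by apply: is_derive_eq; rewrite subr0.
rewrite ler_normr => /orP Ax; apply/eqP; rewrite subr_eq0; apply/eqP.
case: Ax => Ax.
- rewrite -FA; apply: (@eq_of_is_derive0 _ th) => // z.
  rewrite min_r // => Az _; apply: sth; exact: le_trans (ler_norm _).
- apply: (@eq_of_is_derive0 _ th) => // z _.
  rewrite max_r; last lra.
  by move=> Az; apply: sth; rewrite -normrN; apply: le_trans (ler_norm _); lra.
Qed.

(** Integration by parts moves one derivative from [th] to [g]: the boundary terms vanish with [F],
    and the chain-rule factor [2^-j] is nonzero and divides out. This is the induction step that
    feeds the next vanishing integral. *)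
Lemma dyadic_orthogonal_primitive g g' F th A : 0 < A ->
  (forall x, is_derive x 1 g (g' x)) -> continuous g' ->
  (forall x, is_derive x 1 F (th x)) -> continuous th -> supported A F ->
  (forall (j : nat) (k : int), (0 < j)%N ->
     \int[mu]_(y in `[- A, A]) (g (2^-1 ^+ j * (k%:~R + y)) * th y) = 0) ->
  forall (j : nat) (k : int), (0 < j)%N ->
     \int[mu]_(y in `[- A, A]) (g' (2^-1 ^+ j * (k%:~R + y)) * F y) = 0.
Proof.
move=> A0 dg cg' dF cth sF orth j k j0.
set h := 2^-1 ^+ j.
have h0 : h != 0 by rewrite expf_neq0 // invr_eq0.
have cF : continuous F by move=> x; exact: is_derive_continuous (dF x).
have cg1 : continuous (fun y => g' (h * (k%:~R + y))) by exact: continuous_affine.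
suff : \int[mu]_(y in `[- A, A]) (g (h * (k%:~R + y)) * th y) =
    - \int[mu]_(y in `[- A, A]) (h * g' (h * (k%:~R + y)) * F y).
  rewrite orth //; under eq_Rintegral do rewrite -mulrA.
  rewrite RintegralZl //.
    by move/esym/eqP; rewrite oppr_eq0 mulf_eq0 (negbTE h0) /= => /eqP.
  apply: continuous_on_integrable => y _.
  by apply: continuousM; [exact: cg1|exact: cF].
apply: Rintegral_parts0.
- lra.
- by move=> x _; exact: is_derive_affine.
- by move=> x _; apply: continuousM; [exact: cst_continuous|exact: cg1].
- by move=> x _; exact: cth.
- by rewrite sF // normrN ler_norm.
- by rewrite sF // ler_norm.
Qed.

Lemma Rintegral_supported f A : (forall x, A <= `|x| -> f x = 0) ->
  \int[mu]_x f x = \int[mu]_(x in `[- A, A]) f x.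
Proof.
move=> f0; rewrite [RHS]Rintegral_mkcond; apply: eq_Rintegral => x _.
rewrite patchE; case: ifPn => // /negP; rewrite inE /= in_itv /= => xA.
apply: f0; rewrite leNgt; apply/negP => /ltW; rewrite ler_norml; exact: xA.
Qed.

(** This is the orthogonality of [wav psi 0 0] and [wav psi j k] after the substitution
    [x = 2^-j (k + y)], which turns the scale 0 wavelet into the stretched factor. *)
Lemma wavelet_dyadic_orthogonal psi A : 0 < A -> continuous psi -> supported A psi ->
  generates_ONB psi -> forall (j : nat) (k : int), (0 < j)%N ->
  \int[mu]_(y in `[- A, A]) (psi (2^-1 ^+ j * (k%:~R + y)) * psi y) = 0.
Proof.
move=> A0 cpsi spsi [orth _] j k j0.
have AA : - A < A by lra.
set h := 2^-1 ^+ j.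
have h0 : 0 < h by rewrite exprn_gt0 // invr_gt0.
have [_ ] := orth 0 0 j k.
have -> : (0 == j%:Z) && (0 == k) = false by case: j j0 {h h0}.
have pj : (2 : R) `^ j%:Z%:~R = h^-1 by rewrite powR_mulrn // /h exprVn invrK.
pose c := (2 : R) `^ (j%:Z%:~R / 2).
have c0 : 0 < c by exact: powR_gt0.
have -> : \int[mu]_(x in setT) (wav psi 0 0 x * wav psi j k x) =
   \int[mu]_x (c * (psi x * psi (h^-1 * x - k%:~R))).
  apply: eq_Rintegral => x _; rewrite /wav pj mul0r powRr0 !mul1r subr0 -/c; ring.
rewrite (@Rintegral_supported _ A); last by move=> x xA; rewrite spsi // mul0r mulr0.
have c1 : continuous (fun x => psi (h^-1 * x - k%:~R)).
  have -> : (fun x => psi (h^-1 * x - k%:~R)) = (fun x => psi (h^-1 * (- (h * k%:~R) + x))).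
    by apply/funext => x; rewrite mulrDr mulrN mulrA mulVf ?gt_eqF // mul1r addrC.
  exact: continuous_affine.
rewrite RintegralZl //; last first.
  apply: continuous_on_integrable => y _.
  by apply: continuousM; [exact: cpsi|exact: c1].
move/eqP; rewrite mulf_eq0 gt_eqF //= => /eqP.
pose f y := psi (h * (k%:~R + y)) * psi y.
have cf : continuous f.
  by move=> y; apply: continuousM; [exact: continuous_affine|exact: cpsi].
(* The substitution is carried out on a primitive: both integrals become differences of values of
   [F], at [A] and [-A] for one and at their preimages under [y -> h (k + y)] for the other. *)
have [F dF] := @continuous_primitive R f cf.
have -> : \int[mu]_(y in `[- A, A]) (psi (h * (k%:~R + y)) * psi y) = F A - F (- A).
  by apply: Rintegral_FTC2 => // y _; exact: cf.
have -> : \int[mu]_(x in `[- A, A]) (psi x * psi (h^-1 * x - k%:~R)) =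
   h * F (h^-1 * (- (h * k%:~R) + A)) - h * F (h^-1 * (- (h * k%:~R) + - A)).
  apply: (@Rintegral_FTC2 R (fun x => h * F (h^-1 * (- (h * k%:~R) + x)))) => // y _.
    have dFy := @is_derive_affine F h^-1 (- (h * k%:~R)) y _ (dF _).
    apply: is_derive_eq; rewrite /GRing.scale /= ?(mulr0, mul0r, addr0, add0r).
    rewrite mulrA mulfV ?gt_eqF // mul1r /f.
    congr (psi _ * psi _).
      by rewrite mulrDr mulrA mulfV ?gt_eqF // mul1r; ring.
    by rewrite mulrDr mulrN mulrA mulVf ?gt_eqF // mul1r addrC.
  by apply: continuousM; [exact: cpsi|exact: c1].
rewrite -mulrBr => /eqP; rewrite mulf_eq0 gt_eqF //= => /eqP.
have hz z : h * (k%:~R + (h^-1 * (- (h * k%:~R) + z))) = z.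
  by rewrite mulrDr mulrA mulfV ?gt_eqF // mul1r; ring.
have le_hz z u : h^-1 * (- (h * k%:~R) + z) <= u -> z <= h * (k%:~R + u).
  by rewrite -{2}(hz z) ler_pM2l // lerD2l.
have ge_hz z u : u <= h^-1 * (- (h * k%:~R) + z) -> h * (k%:~R + u) <= z.
  by rewrite -{2}(hz z) ler_pM2l // lerD2l.
(* Between the two right endpoints one factor of [f] is already outside its support, so [F] takes
   the same value at both; the left endpoints are treated likewise. *)
rewrite (@eq_of_is_derive0 F f _ A) // => [|z zA _]; last first.
  move: zA; rewrite ge_min => /orP[/le_hz|] zA; rewrite /f.
    by rewrite spsi ?mul0r //; apply: le_trans (ler_norm _).
  by rewrite [psi z]spsi ?mulr0 //; apply: le_trans (ler_norm _).
rewrite (@eq_of_is_derive0 F f (h^-1 * _) (- A)) // => z _.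
rewrite le_max => /orP[/ge_hz|] zA; rewrite /f.
  by rewrite spsi ?mul0r // -normrN; apply: le_trans (ler_norm _); lra.
by rewrite [psi z]spsi ?mulr0 // -normrN; apply: le_trans (ler_norm _); lra.
Qed.

Lemma wavelet_neq0 psi : generates_ONB psi -> exists x, psi x != 0.
Proof.
move=> [orth _]; have [_] := orth 0 0 0 0; rewrite eqxx /= => i1.
apply: contrapT => /forallNP p0.
have : \int[mu]_x (wav psi 0 0 x * wav psi 0 0 x) = \int[mu]_x (cst 0 x).
  apply: eq_Rintegral => x _; rewrite /wav.
  have /negP/negPn/eqP -> := p0 ((2 : R) `^ 0%:~R * x - 0%:~R).
  by rewrite mulr0 mul0r.
rewrite i1 /Rintegral integral0 /= => /eqP; by rewrite oner_eq0.
Qed.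

Lemma C3_is_derive psi : C3 psi ->
  [/\ forall x : R, is_derive x 1 psi (derive1 psi x),
      forall x : R, is_derive x 1 (derive1 psi) (derive1n 2 psi x) &
      continuous (derive1n 2 psi)].
Proof.
move=> [d0 [d1 [d2 _]]]; split => x.
- by apply: DeriveDef; [exact: d0|rewrite derive1E].
- by apply: DeriveDef; [exact: d1|exact/esym/(derive1E (derive1 psi))].
- exact/differentiable_continuous/derivable1_diffP/d2.
Qed.

(** Each round tests the current primitive against [psi], [psi'] or [psi''], which must not vanish
    identically: [psi] has norm 1, [psi'] is nonzero because [psi] is not constant, and [psi'']
    because [psi'] takes both a nonzero value and, by the mean value theorem beyond the support, the
    value 0. *)
Lemma wavelet_iterated_primitives psi :
  C3 psi -> compact_support psi -> generates_ONB psi ->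
  exists A : R, exists th1 th2 th3 : R -> R,
    [/\ 0 < A, supported A psi, supported A th1, supported A th2 & supported A th3] /\
    [/\ forall x : R, is_derive x 1 th1 (psi x),
      forall x : R, is_derive x 1 th2 (th1 x) &
      forall x : R, is_derive x 1 th3 (th2 x)].
Proof.
move=> /C3_is_derive[d0 d1 c2] [a [b sab]] onb.
have c0 : continuous psi by move=> x; exact: is_derive_continuous (d0 x).
have c1 : continuous (derive1 psi) by move=> x; exact: is_derive_continuous (d1 x).
pose A : R := `|a| + `|b| + 1.
have A0 : 0 < A by rewrite ltr_wpDl // addr_ge0.
have s0 : supported A psi.
  move=> x Ax; apply: sab; rewrite in_itv /= => /andP[ax xb]; move: Ax; apply/negP.
  rewrite -ltNge ltr_norml /A.
  have := ler_norm (- a); have := ler_norm b; rewrite normrN.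
  have := normr_ge0 a; have := normr_ge0 b; move=> ????; apply/andP; lra.
have [x0 x0P] := wavelet_neq0 onb.
have sA x : A <= x -> psi x = 0.
  by move=> Ax; apply: s0; apply: le_trans Ax _; exact: ler_norm.
have nz1 : exists x, derive1 psi x != 0.
  by apply: (@derive_neq0 psi _ x0 A d0); rewrite (sA A).
have [z z0] : exists z, derive1 psi z = 0.
  apply: contrapT => /forallNP nz.
  have [||c _] := @MVT_segment R psi (derive1 psi) A (A + 1).
  - by rewrite lerDl.
  - by apply: continuous_on_within => x _; exact: c0.
  - rewrite !sA ?lerDl // subrr addrAC subrr add0r mulr1 => /esym c'; exact: (nz c).
have nz2 : exists x, derive1n 2 psi x != 0.
  by have [x1 x1P] := nz1; apply: (@derive_neq0 (derive1 psi) _ x1 z d1); rewrite z0.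
have o0 := wavelet_dyadic_orthogonal A0 c0 s0 onb.
have i0 := integral_eq0_of_dyadic_orthogonal A0 c0 c0 (ex_intro _ x0 x0P) o0.
have [th1 dth1 s1] := supported_primitive A0 c0 s0 i0.
have ct1 : continuous th1 by move=> x; exact: is_derive_continuous (dth1 x).
have o1 := dyadic_orthogonal_primitive A0 d0 c1 dth1 c0 s1 o0.
have i1 := integral_eq0_of_dyadic_orthogonal A0 c1 ct1 nz1 o1.
have [th2 dth2 s2] := supported_primitive A0 ct1 s1 i1.
have ct2 : continuous th2 by move=> x; exact: is_derive_continuous (dth2 x).
have o2 := dyadic_orthogonal_primitive A0 d1 c2 dth2 ct1 s2 o1.
have i2 := integral_eq0_of_dyadic_orthogonal A0 c2 ct2 nz2 o2.
have [th3 dth3 s3] := supported_primitive A0 ct2 s2 i2.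
by exists A, th1, th2, th3.
Qed.

End Moments.

(** * Convolution with a truncated power *)

Section KernelConvolution.
Variable R : realType.
Implicit Types (f g F G p q phi : R -> R) (a b x y z r s m K : R).
Local Notation mu := (@lebesgue_measure R).

(** Since all bounds are linear in [K], the class contains truncated powers and also differences of
    two of them, with [K] proportional to the gap between exponents. Near 0 only a bound is asked,
    because [r^k] with [k < 1] is not Lipschitz there. The range [2 * A + 1] is that of [x - s] for
    [x <= A + 1]; for [x >= A + 1] one has [x - s >= 1] and the third derivative takes over. *)
Definition smooth_kernel (A K : R) phi :=
  [/\ continuous phi, forall r, r <= 0 -> phi r = 0,
      forall r, r <= 2 * A + 1 -> `|phi r| <= K &
      exists p1 p2 p3 : R -> R,
      [/\ forall r, 0 < r -> is_derive r 1 phi (p1 r),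
          forall r, 0 < r -> is_derive r 1 p1 (p2 r),
          forall r, 0 < r -> is_derive r 1 p2 (p3 r),
          forall r, 0 < r -> {for r, continuous p3} &
          forall r, 1 <= r -> `|p3 r| <= K / r ^+ 2]].

Lemma is_derive_rsub p x s l : is_derive (x - s) 1 p l ->
  is_derive s 1 (fun s => p (x - s)) (- l).
Proof.
move=> dp.
have dg : is_derive s 1 (fun s => x - s) (- 1).
  by apply: is_derive_eq (is_deriveB (is_derive_cst _ _ _) (is_derive_id _ _)) _; rewrite sub0r.
have := @is_derive1_comp R p (fun s => x - s) s l (- 1) dp dg.
by rewrite mulrN1.
Qed.

Lemma continuous_rsub p x s : {for x - s, continuous p} ->
  {for s, continuous (fun s => p (x - s))}.
Proof.
move=> cp; apply: (@continuous_comp _ _ _ (fun s => x - s) p) => //.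
by apply: continuousB; [exact: cst_continuous|exact: cvg_id].
Qed.

Variables (A : R).
Hypothesis A0 : 0 < A.

Let AA : - A < A.
Proof. by move: A0; lra. Qed.

Definition kconv p f x := \int[mu]_(s in `[- A, A]) (p (x - s) * f s).

Lemma conv_parts p q F f x :
  (forall s, - A <= s <= A -> is_derive (x - s) 1 p (q (x - s))) ->
  (forall s, - A <= s <= A -> {for x - s, continuous q}) ->
  (forall s, is_derive s 1 F (f s)) -> continuous f -> supported A F ->
  kconv p f x = kconv q F x.
Proof.
have A_gt0 := A0.
move=> dp cq dF cf sF.
have -> : kconv p f x = - \int[mu]_(s in `[- A, A]) (- q (x - s) * F s).
  apply: Rintegral_parts0.
  - exact: AA.
  - by move=> s sA; apply/is_derive_rsub/dp.
  - by move=> s sA; apply: continuousN; apply/continuous_rsub/cq.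
  - by move=> s _; exact: cf.
  - by rewrite sF // normrN ler_norm.
  - by rewrite sF // ler_norm.
have cF : continuous F by move=> s; exact: is_derive_continuous (dF s).
rewrite /kconv; under eq_Rintegral do rewrite mulNr -mulN1r.
rewrite RintegralZl ?mulN1r ?opprK //.
apply: continuous_on_integrable => s sA.
by apply: continuousM; [apply/continuous_rsub/cq|exact: cF].
Qed.

Lemma conv_bound p f x K B : continuous f ->
  (forall s, - A <= s <= A -> {for x - s, continuous p}) ->
  (forall s, - A <= s <= A -> `|p (x - s)| <= K) ->
  (forall s, - A <= s <= A -> `|f s| <= B) ->
  `|kconv p f x| <= K * B * (2 * A).
Proof.
have A_gt0 := A0.
move=> cf cp pK fB; have -> : 2 * A = A - - A by ring.
apply: Rintegral_itv_bound; first exact: ltW AA.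
  by move=> s sA; apply: continuousM; [exact/continuous_rsub/cp|exact: cf].
by move=> s sA; rewrite normrM ler_pM // ?pK ?fB.
Qed.

Lemma conv_diff_bound p f x y K B : continuous f ->
  (forall s, - A <= s <= A -> {for x - s, continuous p}) ->
  (forall s, - A <= s <= A -> {for y - s, continuous p}) ->
  (forall s, - A <= s <= A -> `|p (y - s) - p (x - s)| <= K) ->
  (forall s, - A <= s <= A -> `|f s| <= B) ->
  `|kconv p f y - kconv p f x| <= K * B * (2 * A).
Proof.
have A_gt0 := A0.
move=> cf cpx cpy pK fB; have -> : 2 * A = A - - A by ring.
rewrite /kconv -RintegralB //; first last.
- apply: continuous_on_integrable => s sA.
  by apply: continuousM; [exact/continuous_rsub/cpx|exact: cf].
- apply: continuous_on_integrable => s sA.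
  by apply: continuousM; [exact/continuous_rsub/cpy|exact: cf].
under eq_Rintegral do rewrite -mulrBl.
apply: Rintegral_itv_bound; first exact: ltW AA.
  move=> s sA; apply: continuousM; last exact: cf.
  by apply: continuousB; apply/continuous_rsub; [exact: cpy|exact: cpx].
by move=> s sA; rewrite normrM ler_pM // ?pK ?fB.
Qed.

Lemma conv_left p f x : (forall r, r <= 0 -> p r = 0) -> x <= - A -> kconv p f x = 0.
Proof.
have A_gt0 := A0.
move=> p0 xA; rewrite /kconv.
have -> : 0 = \int[mu]_(s in `[- A, A]) (cst 0 s) by rewrite /Rintegral integral0.
apply: eq_Rintegral => s; rewrite inE /= in_itv /= => /andP[As _].
by rewrite p0 ?mul0r //; lra.
Qed.

Variables (psi dpsi th1 th2 th3 : R -> R).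
Hypotheses (d0 : forall x : R, is_derive x 1 psi (dpsi x)) (c1 : continuous dpsi).
Hypotheses (dth1 : forall x : R, is_derive x 1 th1 (psi x))
  (dth2 : forall x : R, is_derive x 1 th2 (th1 x))
  (dth3 : forall x : R, is_derive x 1 th3 (th2 x)).
Hypotheses (s0 : supported A psi) (s1 : supported A th1) (s2 : supported A th2)
  (s3 : supported A th3).

Let c0 : continuous psi. Proof. by move=> x; exact: is_derive_continuous (d0 x). Qed.
Let ct1 : continuous th1. Proof. by move=> x; exact: is_derive_continuous (dth1 x). Qed.
Let ct2 : continuous th2. Proof. by move=> x; exact: is_derive_continuous (dth2 x). Qed.
Let ct3 : continuous th3. Proof. by move=> x; exact: is_derive_continuous (dth3 x). Qed.

Lemma kernel_ge0 K phi : smooth_kernel A K phi -> 0 <= K.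
Proof.
by case=> _ _ /(_ 0) k0 _; apply: le_trans (k0 _) => //; move: A0; lra.
Qed.

Lemma conv_kernel_parts2 phi p1 p2 x :
  (forall r, 0 < r -> is_derive r 1 phi (p1 r)) ->
  (forall r, 0 < r -> is_derive r 1 p1 (p2 r)) ->
  (forall r, 0 < r -> {for r, continuous p2}) -> A < x ->
  kconv phi psi x = kconv p2 th2 x.
Proof.
have A_gt0 := A0.
move=> dp0 dp1 cp2 Ax.
transitivity (kconv p1 th1 x); apply: conv_parts => // s sA.
- apply: dp0; lra.
- apply: is_derive_continuous; apply: dp1; lra.
- apply: dp1; lra.
- apply: cp2; lra.
Qed.

(** The constant [A + 4] gives equality at [x = A + 1], where both sides are 1. *)
Lemma dist_support_ge x : A + 1 <= x -> (3 + `|x|) / (A + 4) <= x - A.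
Proof.
have A_gt0 := A0.
move=> Ax; rewrite ler_pdivrMr; last lra.
rewrite ger0_norm; last lra.
rewrite -subr_ge0.
have -> : (x - A) * (A + 4) - (3 + x) = (A + 3) * (x - A - 1) by ring.
by rewrite mulr_ge0 //; lra.
Qed.

Lemma kernel_tail_bound K (p3 : R -> R) r m : 0 <= K -> 0 < m ->
  (forall r, 1 <= r -> `|p3 r| <= K / r ^+ 2) -> 1 <= r -> m / (A + 4) <= r ->
  `|p3 r| <= K * (A + 4) ^+ 2 / m ^+ 2.
Proof.
have A_gt0 := A0.
move=> K0 m0 pK r1 mr; apply: le_trans (pK r r1) _.
rewrite -mulrA ler_wpM2l //.
have mA : 0 < m / (A + 4) by rewrite divr_gt0 //; lra.
rewrite -[X in _ <= X]invf_div -expr_div_n lef_pV2 ?posrE ?exprn_gt0 //; last lra.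
by rewrite lerXn2r ?nnegrE //; lra.
Qed.

Let bnd : exists2 B, 0 < B & forall s, - A <= s <= A ->
  [/\ `|psi s| <= B, `|dpsi s| <= B, `|th2 s| <= B & `|th3 s| <= B].
Proof.
have A_gt0 := A0.
have [B0 B00 P0] := @segment_bounded R psi (- A) A c0.
have [B1 B10 P1] := @segment_bounded R dpsi (- A) A c1.
have [B2 B20 P2] := @segment_bounded R th2 (- A) A ct2.
have [B3 B30 P3] := @segment_bounded R th3 (- A) A ct3.
exists (B0 + B1 + B2 + B3) => [|s sA]; first by rewrite !addr_gt0.
have := P0 s sA; have := P1 s sA; have := P2 s sA; have := P3 s sA.
move=> ????; split; lra.
Qed.

(** To the right of the support, three integrations by parts bring in the third derivative; to the
    left the integral is 0; in between, [3 + |x| <= A + 4] and a crude bound suffices. *)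
Lemma conv_kernel_decay : exists2 C, 0 < C &
  forall K phi x, smooth_kernel A K phi -> `|kconv phi psi x| <= C * K / (3 + `|x|) ^+ 2.
Proof.
have A_gt0 := A0.
have [B B0 BP] := bnd.
exists (B * (2 * A) * (A + 4) ^+ 2).
  by apply: mulr_gt0; [apply: mulr_gt0 => //; lra|apply: exprn_gt0; lra].
move=> K phi x kphi; have K0 := kernel_ge0 kphi.
case: kphi => cphi phi0 phiK [p1 [p2 [p3 [dp1 dp2 dp3 cp3 p3K]]]].
have D0 : 0 < 3 + `|x| by rewrite ltr_pwDl.
have [Ax|xA] := leP (A + 1) x.
  have -> : kconv phi psi x = kconv p3 th3 x.
    transitivity (kconv p2 th2 x).
      apply: (@conv_kernel_parts2 phi p1 p2) => //; last lra.
      by move=> r r0; apply: is_derive_continuous; exact: dp3.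
    apply: conv_parts => // s sA; [apply: dp3; lra|apply: cp3; lra].
  apply: (le_trans (@conv_bound p3 th3 x (K * (A + 4) ^+ 2 / (3 + `|x|) ^+ 2) B _ _ _ _)) => //.
  - move=> s sA; apply: cp3; lra.
  - move=> s sA; apply: kernel_tail_bound => //; first lra.
    apply: le_trans (dist_support_ge Ax) _; lra.
  - by move=> s /BP[].
  - by rewrite le_eqVlt; apply/orP; left; apply/eqP; ring.
have [xA'|xA'] := leP x (- A).
  by rewrite conv_left // normr0 divr_ge0 ?exprn_ge0 ?mulr_ge0 ?(ltW B0) //; lra.
apply: (le_trans (@conv_bound phi psi x K B _ _ _ _)) => //.
- move=> s sA; exact: cphi.
- move=> s sA; apply: phiK; lra.
- by move=> s /BP[].
rewrite ler_pdivlMr ?exprn_gt0 //.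
have -> : B * (2 * A) * (A + 4) ^+ 2 * K = K * B * (2 * A) * (A + 4) ^+ 2 by ring.
apply: ler_wpM2l; first by rewrite !mulr_ge0 // ltW //; lra.
apply: lerXn2r; rewrite ?nnegrE; [exact: ltW|lra|].
have : `|x| <= A + 1 by rewrite ler_norml; apply/andP; lra.
lra.
Qed.

(** To the right of [A + 1] two integrations by parts leave the second derivative of the kernel,
    which is Lipschitz through the third. To the left the kernel may be singular at 0, so the
    smoothness of [psi] is used instead. An interval containing [A + 1] is cut there. *)
Lemma conv_kernel_lipschitz : exists2 C, 0 < C &
  forall K phi x y m, smooth_kernel A K phi -> 0 < m -> x <= y ->
    (forall z, x <= z <= y -> m <= 3 + `|z|) ->
    `|kconv phi psi y - kconv phi psi x| <= C * K * (y - x) / m ^+ 2.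
Proof.
have A_gt0 := A0.
have [B B0 BP] := bnd.
exists (B * (2 * A) * (A + 4) ^+ 2).
  by apply: mulr_gt0; [apply: mulr_gt0 => //; lra|apply: exprn_gt0; lra].
move=> K phi x y m kphi m0; have K0 := kernel_ge0 kphi.
case: kphi => cphi phi0 phiK [p1 [p2 [p3 [dp1 dp2 dp3 cp3 p3K]]]].
set C := B * (2 * A) * _.
have cp2 r : 0 < r -> {for r, continuous p2}.
  by move=> r0; apply: is_derive_continuous; exact: dp3.
have right u v : A + 1 <= u -> u <= v -> (forall z, u <= z <= v -> m <= 3 + `|z|) ->
    `|kconv phi psi v - kconv phi psi u| <= C * K * (v - u) / m ^+ 2.
  move=> Au uv mz.
  have E w : A + 1 <= w -> kconv phi psi w = kconv p2 th2 w.
    by move=> Aw; apply: (@conv_kernel_parts2 phi p1 p2) => //; lra.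
  rewrite !E //; last lra.
  apply: (le_trans (@conv_diff_bound p2 th2 u v (K * (A + 4) ^+ 2 / m ^+ 2 * (v - u)) B _ _ _ _ _)) => //.
  - move=> s sA; apply: cp2; lra.
  - move=> s sA; apply: cp2; lra.
  - move=> s sA; have -> : v - u = (v - s) - (u - s) by ring.
    apply: (@le_diff_MVT R p2 p3); first lra.
      move=> z zuv; apply: dp3; lra.
    move=> z zuv; apply: kernel_tail_bound => //; first lra.
    have zA : A + 1 <= z + s by lra.
    apply: (@le_trans _ _ (z + s - A)); last lra.
    apply: le_trans (dist_support_ge zA).
    rewrite ler_pM2r; last by rewrite invr_gt0; lra.
    apply: mz; lra.
  - by move=> s /BP[].
  - by rewrite le_eqVlt; apply/orP; left; apply/eqP; rewrite /C; ring.
have left u v : v <= A + 1 -> u <= v -> (forall z, u <= z <= v -> m <= 3 + `|z|) ->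
    `|kconv phi psi v - kconv phi psi u| <= C * K * (v - u) / m ^+ 2.
  move=> vA uv mz.
  have [vA'|vA'] := leP v (- A).
    rewrite !conv_left //; last lra.
    rewrite subr0 normr0 divr_ge0 ?exprn_ge0 ?mulr_ge0 ?(ltW B0) //; lra.
  (* Integrating by parts in the opposite direction replaces the kernel by its primitive [Phi],
     whose Lipschitz constant is a bound on [phi], at the cost of differentiating [psi] once. *)
  have [Phi dPhi] := continuous_primitive cphi.
  have cPhi : continuous Phi by move=> z; exact: is_derive_continuous (dPhi z).
  have E w : kconv phi psi w = kconv Phi dpsi w.
    by apply/esym/conv_parts => // s _; exact: cphi.
  rewrite !E.
  apply: (le_trans (@conv_diff_bound Phi dpsi u v (K * (v - u)) B _ _ _ _ _)) => //.
  - by move=> s _; exact: cPhi.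
  - by move=> s _; exact: cPhi.
  - move=> s sA; have -> : v - u = (v - s) - (u - s) by ring.
    apply: (@le_diff_MVT R Phi phi) => //; first lra.
    move=> z zuv; apply: phiK; lra.
  - by move=> s /BP[].
  rewrite ler_pdivlMr ?exprn_gt0 //.
  have -> : C * K * (v - u) = K * (v - u) * B * (2 * A) * (A + 4) ^+ 2 by rewrite /C; ring.
  apply: ler_wpM2l; first by rewrite !mulr_ge0 // ?subr_ge0 // ltW //; lra.
  apply: lerXn2r; rewrite ?nnegrE; [exact: ltW|lra|].
  have : `|v| <= A + 1 by rewrite ler_norml; apply/andP; lra.
  have := mz v; rewrite uv lexx => /(_ isT); lra.
move=> xy mz.
have [yA|Ay] := leP y (A + 1); first exact: left.
have [Ax|xA] := leP (A + 1) x; first exact: right.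
have -> : kconv phi psi y - kconv phi psi x = (kconv phi psi y - kconv phi psi (A + 1)) +
  (kconv phi psi (A + 1) - kconv phi psi x) by ring.
have -> : C * K * (y - x) / m ^+ 2 = C * K * (y - (A + 1)) / m ^+ 2 +
  C * K * (A + 1 - x) / m ^+ 2 by rewrite -mulrDl -mulrDr; congr (_ * _ / _); ring.
apply: le_trans (ler_normD _ _) _; apply: lerD.
  apply: right => //; first exact: ltW.
  by move=> z /andP[Az zy]; apply: mz; rewrite zy andbT; lra.
apply: left => //; first exact: ltW.
by move=> z /andP[Az zy]; apply: mz; rewrite Az /=; lra.
Qed.

End KernelConvolution.

(** * Truncated powers and their dependence on the exponent *)

Section PosPow.
Variable R : realType.
Implicit Types (a b x y r k K : R).

Lemma expR_lipschitz x y M : x <= M -> y <= M ->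
  `|expR x - expR y| <= `|x - y| * expR M :> R.
Proof.
wlog xy : x y / y <= x => [wl xM yM|xM yM].
  case/orP: (le_total y x) => yx; first exact: wl.
  by rewrite distrC (distrC x); exact: wl.
rewrite !ger0_norm ?subr_ge0 ?ler_expR //.
have -> : expR x - expR y = expR x * (1 - expR (y - x)).
  by rewrite mulrBr mulr1 -expRD; congr (_ - expR _); ring.
apply: (@le_trans _ _ (expR x * (x - y))).
  rewrite ler_wpM2l ?expR_ge0 //.
  have := expR_ge1Dx (y - x); lra.
by rewrite mulrC ler_wpM2l ?subr_ge0 // ler_expR.
Qed.

Lemma powR_expR r k : 0 < r -> r `^ k = expR (k * ln r).
Proof. by move=> r0; rewrite /powR gt_eqF. Qed.

Lemma powR_lipschitz_ge1 r a b k : 1 <= r -> a <= k -> b <= k ->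
  `|r `^ a - r `^ b| <= `|a - b| * (ln r * r `^ k).
Proof.
move=> r1 ak bk; have r0 : 0 < r by lra.
have l0 : 0 <= ln r by rewrite ln_ge0.
rewrite !powR_expR //; apply: le_trans (@expR_lipschitz _ _ (k * ln r) _ _) _.
- exact: ler_wpM2r.
- exact: ler_wpM2r.
by rewrite -mulrBl normrM (ger0_norm l0) mulrA.
Qed.

(** The slope in the exponent is at most [|ln r| r^k], and [1 + x <= exp x] at [x = - k ln r] bounds
    it by [1 / k]. The constant blows up as [k] tends to 0, hence the need to keep exponents away
    from 0. *)
Lemma powR_lipschitz_le1 r a b k : 0 < r -> r <= 1 -> 0 < k -> k <= a -> k <= b ->
  `|r `^ a - r `^ b| <= `|a - b| / k.
Proof.
move=> r0 r1 k0 ka kb.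
have l0 : ln r <= 0 by exact: ln_le0.
rewrite !powR_expR //; apply: le_trans (@expR_lipschitz _ _ (k * ln r) _ _) _.
- exact: ler_wnM2r.
- exact: ler_wnM2r.
rewrite -mulrBl normrM -mulrA ler_wpM2l // -ler_pdivlMr ?expR_gt0 //.
rewrite -expRN ler0_norm //.
rewrite -(ler_pM2l k0) mulrA mulfV ?gt_eqF // mul1r.
have := expR_ge1Dx (- (k * ln r)); lra.
Qed.

Lemma continuous_pospow k : 0 < k -> continuous (fun r => pospow r k).
Proof.
move=> k0 r; case: (ltgtP r 0) => r0.
- have E : \near r, cst 0 r = pospow r k.
    by near=> z; rewrite /pospow ltNge ltW //; near: z; exact: lt_nbhsl.
  have c : {for r, continuous (cst 0 : R -> R)} by exact: cst_continuous.
  rewrite /continuous_at /= in c *.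
  rewrite -(nbhs_singleton E); apply: cvg_trans c; exact: near_eq_cvg.
- have E : \near r, r `^ k = pospow r k.
    near=> z; rewrite /pospow ifT //; near: z; exact: lt_nbhsr.
  have c : {for r, continuous (fun r => r `^ k)}.
    exact: (is_derive_continuous (is_derive1_powR k r0)).
  rewrite /continuous_at /= in c *.
  rewrite -(nbhs_singleton E); apply: cvg_trans c; exact: near_eq_cvg.
rewrite r0; apply/left_right_continuousP; rewrite /pospow ltxx; split.
  apply: (@cvg_trans _ (cst (0 : R) @ 0^'-)); last exact: cvg_cst.
  apply: near_eq_cvg.
  by near=> z; rewrite /= ltNge ltW.
apply: cvg_trans (powR_cvg0 k0); apply: near_eq_cvg.
by near=> z; rewrite ifT.
Unshelve. all: by end_near. Qed.

Definition pow1 k r : R := k * r `^ (k - 1).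
Definition pow2 k r : R := k * ((k - 1) * r `^ (k - 1 - 1)).
Definition pow3 k r : R := k * ((k - 1) * ((k - 1 - 1) * r `^ (k - 1 - 1 - 1))).

Lemma is_derive_pospow k r : 0 < r -> is_derive r 1 (fun r => pospow r k) (pow1 k r).
Proof.
move=> r0; apply: (@near_eq_is_derive _ _ _ (fun r => r `^ k)); last exact: is_derive1_powR.
near=> z; rewrite /pospow ifT //; near: z; exact: lt_nbhsr.
Unshelve. all: by end_near. Qed.

Lemma is_derive_pow1 k r : 0 < r -> is_derive r 1 (pow1 k) (pow2 k r).
Proof. by move=> r0; apply: (is_deriveZ k (is_derive1_powR _ r0)). Qed.

Lemma is_derive_pow2 k r : 0 < r -> is_derive r 1 (pow2 k) (pow3 k r).
Proof.
by move=> r0; apply: (is_deriveZ k (is_deriveZ (k - 1) (is_derive1_powR _ r0))).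
Qed.

Lemma continuous_pow3 k r : 0 < r -> {for r, continuous (pow3 k)}.
Proof.
move=> r0; apply: continuousM; first exact: cst_continuous.
apply: continuousM; first exact: cst_continuous.
apply: continuousM; first exact: cst_continuous.
exact: (is_derive_continuous (is_derive1_powR _ r0)).
Qed.

Lemma powR_gt1_le r a n : 1 <= r -> a <= - n%:R -> r `^ a <= (r ^+ n)^-1.
Proof.
by move=> r1 an; rewrite -powR_invn; [exact: ler_powR|lra].
Qed.

Lemma pow3_bound k r : 0 <= k <= 1 / 2 -> 1 <= r -> `|pow3 k r| <= 1 / r ^+ 2.
Proof.
move=> /andP[k0 k1] r1; rewrite /pow3 !mulrA normrM mul1r.
rewrite -[X in _ <= X]mul1r; apply: ler_pM => //.
  rewrite ler_norml; apply/andP; split; nra.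
by rewrite ger0_norm ?powR_ge0 //; apply: powR_gt1_le => //; lra.
Qed.

(** The constant 10 is 8, for the slope of the cubic coefficient, plus 2, for the slope of the
    power. *)
Lemma pow3_lipschitz a b r : 0 <= a <= 1 / 2 -> 0 <= b <= 1 / 2 -> 1 <= r ->
  `|pow3 a r - pow3 b r| <= 10 * `|a - b| / r ^+ 2.
Proof.
move=> /andP[a0 a1] /andP[b0 b1] r1; have r0 : 0 < r by lra.
pose c k : R := k * (k - 1) * (k - 1 - 1).
have -> : pow3 a r - pow3 b r = (c a - c b) * r `^ (a - 1 - 1 - 1) +
    c b * (r `^ (a - 1 - 1 - 1) - r `^ (b - 1 - 1 - 1)) by rewrite /pow3 /c; ring.
have rV : 0 <= (r ^+ 2)^-1 by rewrite invr_ge0 exprn_ge0 // ltW.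
have -> : 10 * `|a - b| / r ^+ 2 = 8 * `|a - b| * (r ^+ 2)^-1 + 1 * (`|a - b| * (2 / r ^+ 2)).
  by field; rewrite gt_eqF.
apply: le_trans (ler_normD _ _) _; apply: lerD; rewrite normrM; apply: ler_pM => //.
- have -> : c a - c b = (a ^+ 2 + a * b + b ^+ 2 - 3 * (a + b) + 2) * (a - b).
    by rewrite /c; ring.
  by rewrite normrM ler_wpM2r // ler_norml; apply/andP; split; nra.
- by rewrite ger0_norm ?powR_ge0 //; apply: powR_gt1_le => //; lra.
- rewrite ler_norml /c; apply/andP; split; nra.
- apply: le_trans (@powR_lipschitz_ge1 r _ _ (- (5 / 2)) r1 _ _) _; [lra|lra|].
  have -> : a - 1 - 1 - 1 - (b - 1 - 1 - 1) = a - b by ring.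
  rewrite ler_wpM2l //.
  (* Exponents at most [-5/2] leave half a power to spare over [r^-2], which pays for
     [ln r <= 2 r^(1/2)]. *)
  have -> : ln r = 2 * ln (r `^ (1 / 2)) by rewrite ln_powR; field.
  rewrite -mulrA ler_wpM2l //.
  apply: (@le_trans _ _ (r `^ (1 / 2) * r `^ (- (5 / 2)))).
    rewrite ler_wpM2r ?powR_ge0 //; apply/ltW/ln_sublinear; exact: powR_gt0.
  rewrite -powRD; last by rewrite (gt_eqF r0) implybT.
  by apply: powR_gt1_le => //; lra.
Qed.

Lemma pospow_le A k r : 0 < A -> 0 < k <= 1 / 2 -> r <= 2 * A + 1 ->
  `|pospow r k| <= 2 * A + 1.
Proof.
move=> A0 /andP[k0 k1] rA; rewrite /pospow; case: ltP => r0; last by rewrite normr0; lra.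
rewrite ger0_norm ?powR_ge0 //; have [r1|r1] := leP r 1.
  apply: (@le_trans _ _ 1); last lra.
  by rewrite -(powRr0 r) ger_powR ?r0 ?r1 ?ltW.
apply: le_trans rA; apply: ler1_powR; lra.
Qed.

Lemma pospow_lipschitz A k a b r : 0 < A -> 0 < k -> k <= a <= 1 / 2 -> k <= b <= 1 / 2 ->
  r <= 2 * A + 1 ->
  `|pospow r a - pospow r b| <= (k^-1 + (2 * A + 1) ^+ 2) * `|a - b|.
Proof.
move=> A0 k0 /andP[ka a1] /andP[kb b1] rA.
have kV : 0 < k^-1 by rewrite invr_gt0.
have A2 : 0 <= (2 * A + 1) ^+ 2 by rewrite exprn_ge0; lra.
rewrite /pospow; case: ltP => r0; last first.
  by rewrite subrr normr0 mulr_ge0 // addr_ge0 // ltW.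
have [r1|r1] := leP r 1.
  apply: le_trans (powR_lipschitz_le1 r0 r1 k0 ka kb) _.
  by rewrite mulrC ler_wpM2r // lerDl.
apply: le_trans (@powR_lipschitz_ge1 r _ _ (1 / 2) _ _ _) _; [lra|lra|lra|].
rewrite mulrC ler_wpM2r //; apply: (@le_trans _ _ ((2 * A + 1) ^+ 2)); last by rewrite lerDr ltW.
rewrite expr2; apply: ler_pM; rewrite ?powR_ge0 ?ln_ge0 //; first exact: ltW.
- by apply: le_trans rA; exact/ltW/ln_sublinear.
- by apply: le_trans rA; apply: ler1_powR; lra.
Qed.

Lemma kernel_pospow (A k1 : R) : 0 < A -> 0 < k1 -> exists2 K : R, 0 < K &
  (forall a, k1 <= a <= 1 / 2 -> smooth_kernel A K (fun r => pospow r a)) /\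
  (forall a b, k1 <= a <= 1 / 2 -> k1 <= b <= 1 / 2 ->
     smooth_kernel A (K * `|a - b|) (fun r => pospow r a - pospow r b)).
Proof.
move=> A0 k10.
have kV : 0 < k1^-1 by rewrite invr_gt0.
have A2 : 0 <= (2 * A + 1) ^+ 2 by rewrite exprn_ge0; lra.
exists (10 + (2 * A + 1) + (k1^-1 + (2 * A + 1) ^+ 2)); first lra.
set K := 10 + _ + _.
have rV r : 1 <= r -> 0 <= (r ^+ 2)^-1 by move=> r1; rewrite invr_ge0 exprn_ge0 //; lra.
split=> [a /andP[ka a1]|a b /andP[ka a1] /andP[kb b1]].
  split.
  - by apply: continuous_pospow; lra.
  - by move=> r r0; rewrite /pospow ltNge r0.
  - move=> r rA; apply: le_trans (pospow_le A0 _ rA) _; rewrite /K; lra.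
  - exists (pow1 a), (pow2 a), (pow3 a); split => r r0.
    + exact: is_derive_pospow.
    + exact: is_derive_pow1.
    + exact: is_derive_pow2.
    + exact: continuous_pow3.
    + apply: le_trans (pow3_bound _ r0) _; first lra.
      by rewrite ler_wpM2r ?rV // /K; lra.
split.
- by move=> r; apply: (@continuousB _ _ _ (fun r => pospow r a) (fun r => pospow r b)); apply: continuous_pospow; lra.
- by move=> r r0; rewrite /pospow ltNge r0 subrr.
- move=> r rA; apply: le_trans (pospow_lipschitz A0 k10 _ _ rA) _; [lra|lra|].
  by rewrite ler_wpM2r // /K; lra.
- exists (fun r => pow1 a r - pow1 b r), (fun r => pow2 a r - pow2 b r),
    (fun r => pow3 a r - pow3 b r); split => r r0.
  + exact: (is_deriveB (is_derive_pospow a r0) (is_derive_pospow b r0)).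
  + exact: (is_deriveB (is_derive_pow1 a r0) (is_derive_pow1 b r0)).
  + exact: (is_deriveB (is_derive_pow2 a r0) (is_derive_pow2 b r0)).
  + by apply: (@continuousB _ _ _ (pow3 a) (pow3 b)); exact: continuous_pow3.
  + apply: le_trans (pow3_lipschitz _ _ r0) _; [lra|lra|].
    by rewrite ler_wpM2r ?rV // ler_wpM2r // /K; lra.
Qed.

End PosPow.

(** * Sums over the integers *)

Section IntegerSums.
Variable R : realType.
Implicit Types (u r : int -> R) (c : int -> int -> R) (M S x t : R).

(** The indexing copies that of [Xpartial], so that the partial sums of the series are instances of
    [sqsum] by conversion. *)
Definition symsum u (N : nat) : R := \sum_(i < (N + N).+1) u (i%:Z - N%:Z).

Definition sqsum c (N : nat) : R := symsum (fun j => symsum (c j) N) N.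

Lemma symsum_le u r N : (forall j, u j <= r j) -> symsum u N <= symsum r N.
Proof. by move=> ur; apply: ler_sum. Qed.

Lemma symsumD u r N : symsum (fun j => u j + r j) N = symsum u N + symsum r N.
Proof. exact: big_split. Qed.

Lemma symsumB u r N : symsum (fun j => u j - r j) N = symsum u N - symsum r N.
Proof. exact: sumrB. Qed.

Lemma symsumZ M u N : symsum (fun j => M * u j) N = M * symsum u N.
Proof. by rewrite /symsum mulr_sumr. Qed.

Lemma symsumS u N :
  symsum u N.+1 = u (- N.+1%:Z) + symsum u N + u N.+1%:Z.
Proof.
rewrite /symsum addSn addnS big_ord_recr /= big_ord_recl /=.
congr (u _ + _ + u _).
- by rewrite sub0r.
- by apply: eq_bigr => i _; congr u; rewrite /bump leq0n add1n -[i.+1]addn1 -[N.+1]addn1 !PoszD; ring.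
- by rewrite -[(N + N).+2]addn2 -[N.+1]addn1 !PoszD; ring.
Qed.

Lemma symsum_nd u : (forall j, 0 <= u j) -> {homo symsum u : m n / (m <= n)%N >-> m <= n}.
Proof.
move=> u0; apply: homo_leq => [|y x z|n]; [exact: lexx|exact: le_trans|].
by rewrite symsumS addrAC ler_wpDl // addr_ge0.
Qed.

Lemma symsum_ge0 u N : (forall j, 0 <= u j) -> 0 <= symsum u N.
Proof. by move=> u0; apply: sumr_ge0. Qed.

Lemma sqsum_nd c : (forall j k, 0 <= c j k) -> {homo sqsum c : m n / (m <= n)%N >-> m <= n}.
Proof.
move=> c0 m n mn; apply: (@le_trans _ _ (symsum (fun j => symsum (c j) n) m)).
  by apply: symsum_le => j; exact: symsum_nd.
by apply: symsum_nd => // j; exact: symsum_ge0.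
Qed.

Lemma sqsum_le_rows c r M N :
  (forall j N, symsum (c j) N <= r j) -> symsum r N <= M -> sqsum c N <= M.
Proof. by move=> cr; apply: le_trans; exact: symsum_le. Qed.

Lemma sqsum_le c c' N : (forall j k, c j k <= c' j k) -> sqsum c N <= sqsum c' N.
Proof. by move=> cc; apply: symsum_le => j; apply: symsum_le. Qed.

Lemma sqsumB c c' N : sqsum (fun j k => c j k - c' j k) N = sqsum c N - sqsum c' N.
Proof. by rewrite /sqsum -symsumB; apply: eq_bigr => i _; rewrite symsumB. Qed.

Lemma sqsumD c c' N : sqsum (fun j k => c j k + c' j k) N = sqsum c N + sqsum c' N.
Proof. by rewrite /sqsum -symsumD; apply: eq_bigr => i _; rewrite symsumD. Qed.

Lemma is_cvg_sqsum_ge0 c M : (forall j k, 0 <= c j k) ->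
  (forall N, sqsum c N <= M) -> cvgn (sqsum c).
Proof.
move=> c0 cM; apply: nondecreasing_is_cvgn; first exact: sqsum_nd.
by exists M => _ [N _ <-]; exact: cM.
Qed.

(** Both [|c| + c] and [|c|] are nonnegative with bounded, monotone square sums, and [c] is their
    difference. *)
Lemma is_cvg_sqsum c M : (forall N, sqsum (fun j k => `|c j k|) N <= M) -> cvgn (sqsum c).
Proof.
move=> cM.
have -> : sqsum c = (fun N => sqsum (fun j k => `|c j k| + c j k) N - sqsum (fun j k => `|c j k|) N).
  by apply/funext => N; rewrite sqsumD addrAC subrr add0r.
apply: is_cvgB; last exact: (is_cvg_sqsum_ge0 _ cM).
apply: (@is_cvg_sqsum_ge0 _ (M + M)) => [j k|N].
  by rewrite -lerBlDl sub0r; exact: lerNnormlW.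
rewrite sqsumD; apply: lerD; first exact: cM.
by apply: le_trans (cM N); apply: sqsum_le => j k; exact: ler_norm.
Qed.

Lemma ler_norm_symsum u N : `|symsum u N| <= symsum (fun j => `|u j|) N.
Proof. exact: ler_norm_sum. Qed.

Lemma ler_norm_sqsum c N : `|sqsum c N| <= sqsum (fun j k => `|c j k|) N.
Proof.
apply: le_trans (ler_norm_symsum _ _) _; apply: symsum_le => j; exact: ler_norm_symsum.
Qed.

Lemma ler_norm_limB_sqsum c c' M : cvgn (sqsum c) -> cvgn (sqsum c') ->
  (forall N, sqsum (fun j k => `|c j k - c' j k|) N <= M) ->
  `|limn (sqsum c) - limn (sqsum c')| <= M.
Proof.
move=> cc cc' dM.
have b N : `|sqsum c N - sqsum c' N| <= M.
  by rewrite -sqsumB; apply: le_trans (ler_norm_sqsum _ _) (dM N).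
have cB : cvgn (fun N => sqsum c N - sqsum c' N) by exact: is_cvgB cc cc'.
have -> : limn (sqsum c) - limn (sqsum c') = limn (fun N => sqsum c N - sqsum c' N).
  by rewrite -limB.
rewrite ler_norml; apply/andP; split.
  by apply: (limr_ge cB); near=> N; have := b N; rewrite ler_norml => /andP[].
by apply: (limr_le cB); near=> N; have := b N; rewrite ler_norml => /andP[].
Unshelve. all: by end_near. Qed.

(* [G] is a discrete primitive of [u], so every window sum of [u] is a difference of two values of [G]. *)
Lemma window_sum_le u S1 S2 (p : int) (m : nat) : (forall j, 0 <= u j) ->
  (forall n, \sum_(i < n) u i%:Z <= S1) -> (forall n, \sum_(i < n) u (Negz i) <= S2) ->
  \sum_(i < m) u (p + i%:Z) <= S1 + S2.
Proof.
move=> u0 uS1 uS2.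
pose G (n : int) : R := match n with
  | Posz n => \sum_(i < n) u i%:Z
  | Negz n => - \sum_(i < n.+1) u (Negz i) end.
have GS n : G (n + 1) - G n = u n.
  case: n => [n|[|n]].
  - by rewrite -PoszD addn1 /G big_ord_recr /= addrAC subrr add0r.
  - by rewrite /G /= big_ord0 big_ord1 sub0r opprK.
  - have -> : Negz n.+1 + 1 = Negz n by rewrite !NegzE -[in LHS]addn1 PoszD; ring.
    by rewrite /G opprK [X in _ + X]big_ord_recr /= addrA addNr add0r.
have -> : \sum_(i < m) u (p + i%:Z) = G (p + m%:Z) - G p.
  elim: m => [|m IH]; first by rewrite big_ord0 addr0 subrr.
  have -> : p + m.+1%:Z = p + m%:Z + 1 by rewrite -[m.+1]addn1 PoszD addrA.
  by rewrite big_ord_recr /= IH -GS addrC addrA subrK.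
have S10 : 0 <= S1 by have := uS1 0%N; rewrite big_ord0.
have S20 : 0 <= S2 by have := uS2 0%N; rewrite big_ord0.
apply: lerD.
  case: (p + _) => n /=; first exact: uS1.
  by apply: le_trans S10; rewrite oppr_le0 sumr_ge0.
case: p => n; rewrite /G; last by rewrite opprK; exact: uS2.
by apply: le_trans S20; rewrite oppr_le0 sumr_ge0.
Qed.

(** The bound is free of the shift [p], which is what later gives estimates uniform in the point and
    in the critical scale. *)
Lemma symsum_shift_le u S (p : int) N : (forall j, 0 <= u j) ->
  (forall n, \sum_(i < n) u i%:Z <= S) -> (forall n, \sum_(i < n) u (Negz i) <= S) ->
  symsum (fun j => u (j - p)) N <= S + S.
Proof.
move=> u0 S1 S2; have := @window_sum_le u S S (- N%:Z - p) (N + N).+1 u0 S1 S2.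
by apply: le_trans; apply: ler_sum => i _; rewrite le_eqVlt; apply/orP; left; apply/eqP; congr u; ring.
Qed.

Lemma powR_decay_sum_le t n : 0 < t ->
  \sum_(i < n) (2 + i%:R) `^ (- (1 + t)) <= t^-1 :> R.
Proof.
move=> t0.
(* Comparison with the integral of [y^(-1-t)] in discrete form: with [y = 2 + i] it amounts to
   [(1 - 1/y)^(-t) >= 1 + t/y]. The right-hand sides telescope. *)
have step i : (2 + i%:R) `^ (- (1 + t)) <=
    t^-1 * ((1 + i%:R) `^ (- t)) - t^-1 * ((1 + i.+1%:R) `^ (- t)) :> R.
  set y : R := 2 + i%:R.
  have y2 : 2 <= y by rewrite lerDl.
  have -> : 1 + i.+1%:R = y by rewrite -natr1 /y; ring.
  have -> : 1 + i%:R = y * (1 - y^-1).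
    by rewrite mulrBr mulr1 mulfV; [rewrite /y; ring|rewrite gt_eqF //; lra].
  have yV : y^-1 <= 2^-1 by rewrite lef_pV2 ?posrE //; lra.
  have yV0 : 0 < y^-1 by rewrite invr_gt0; lra.
  rewrite powRM; [|lra|lra].
  have -> : - (1 + t) = - t - 1 by ring.
  rewrite powRD; last by rewrite (gt_eqF (_ : 0 < y)) ?implybT //; lra.
  rewrite powR_inv1; last lra.
  rewrite -mulrBr -(ler_pM2l t0) !mulrA mulfV ?gt_eqF // mul1r mulrAC -[X in _ <= _ - X]mulr1.
  rewrite -mulrBr mulrC ler_wpM2l ?powR_ge0 //.
  rewrite powR_expR; last lra.
  have := expR_ge1Dx (- t * ln (1 - y^-1)).
  have : t * ln (1 - y^-1) <= t * - y^-1.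
    by rewrite ler_wpM2l ?(ltW t0) //; apply: le_ln1Dx; lra.
  rewrite mulNr; lra.
apply: le_trans (ler_sum _ (fun (i : 'I_n) _ => step i)) _.
rewrite -(big_mkord xpredT (fun i => t^-1 * ((1 + i%:R) `^ (- t)) - t^-1 * ((1 + i.+1%:R) `^ (- t)))).
rewrite (eq_bigr (fun i => - (t^-1 * ((1 + i.+1%:R) `^ (- t))) - - (t^-1 * ((1 + i%:R) `^ (- t))))); last first.
  by move=> i _; rewrite opprK addrC.
rewrite telescope_sumr // opprK addr0 powR1 mulr1 addrC lerBlDr lerDl.
by rewrite mulr_ge0 ?powR_ge0 // invr_ge0 ltW.
Qed.

(** Recentring at the integer part of [x] moves points by at most 1, so the weight [3 + |x - k|]
    dominates [2 + |k - n|]. *)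
Lemma symsum_decay_le t x N : 0 < t ->
  symsum (fun k => (3 + `|x - k%:~R|) `^ (- (1 + t))) N <= t^-1 + t^-1.
Proof.
move=> t0; pose n := Num.floor x.
pose u (j : int) : R := (2 + `|j%:~R|) `^ (- (1 + t)).
apply: (@le_trans _ _ (symsum (fun k => u (k - n)) N)); last first.
  apply: symsum_shift_le => [j|m|m]; first exact: powR_ge0.
  - apply: le_trans (powR_decay_sum_le m t0); apply: ler_sum => i _.
    by rewrite /u ger0_norm.
  - apply: le_trans (powR_decay_sum_le m t0); apply: ler_sum => i _.
    rewrite /u NegzE mulrNz normrN ger0_norm // -natr1 powRN powRN.
    rewrite lef_pV2 ?posrE ?powR_gt0 //; try by rewrite ltr_wpDr // addr_ge0.
    by apply: ge0_ler_powR; rewrite ?nnegrE ?addr_ge0 // ?lerD2l ?lerDl //; lra.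
apply: symsum_le => k; rewrite /u !powRN.
rewrite lef_pV2 ?posrE ?powR_gt0 //; try by rewrite ltr_wpDr.
apply: ge0_ler_powR; rewrite ?nnegrE ?addr_ge0 //; first lra.
have := floor_le x; have := floorD1_gt x; rewrite intrD -/n => xn nx.
rewrite rmorphB /= distrC.
have := ler_distD x (n%:~R) (k%:~R).
have : `|n%:~R - x| <= 1 by rewrite ler_norml; apply/andP; lra.
lra.
Qed.

Lemma geometric_sum_le (q : R) n : 0 <= q -> q < 1 -> \sum_(i < n) q ^+ i <= (1 - q)^-1.
Proof.
move=> q0 q1; rewrite -[X in _ <= X]mul1r ler_pdivlMr ?subr_gt0 // mulrC.
suff -> : (1 - q) * \sum_(i < n) q ^+ i = 1 - q ^+ n by rewrite lerBlDr lerDl exprn_ge0.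
elim: n => [|n IH]; first by rewrite big_ord0 mulr0 expr0 subrr.
by rewrite big_ord_recr /= mulrDr IH exprS; ring.
Qed.

Lemma symsum_exp2_le (c : R) (p : int) N : 0 < c ->
  symsum (fun j => 2 `^ (- (c * `|(j - p)%:~R|))) N <=
  (1 - 2 `^ (- c))^-1 + (1 - 2 `^ (- c))^-1.
Proof.
move=> c0; pose u (j : int) : R := 2 `^ (- (c * `|j%:~R|)).
have q1 : (2 : R) `^ (- c) < 1.
  rewrite powR_expR // expR_lt1 mulNr oppr_lt0 mulr_gt0 // ln_gt0 //; lra.
apply: (@symsum_shift_le u) => [j|m|m]; first exact: powR_ge0.
- apply: le_trans (geometric_sum_le m (powR_ge0 _ _) q1); apply: ler_sum => i _.
  by rewrite /u ger0_norm // -mulNr powRrM powR_mulrn ?powR_ge0.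
- apply: le_trans (geometric_sum_le m (powR_ge0 _ _) q1); apply: ler_sum => i _.
  rewrite /u NegzE mulrNz normrN ger0_norm // -mulNr powRrM powR_mulrn ?powR_ge0 //.
  by rewrite exprS ler_piMl ?exprn_ge0 ?powR_ge0 // ltW.
Qed.

End IntegerSums.

(** * Decay and regularity of [Psi] *)

Section PsiEstimates.
Variable R : realType.
Implicit Types (F psi phi : R -> R) (x y z m K v : R).
Local Notation mu := (@lebesgue_measure R).

(* [3 + max 0 (|x| - |y - x|)] is a lower bound of [3 + |z|] for [z] between [x] and [y]. *)
Definition kernel_estimates (F : R -> R -> R) (v0 v1 C : R) := forall v v',
  v0 <= v <= v1 -> v0 <= v' <= v1 ->
  [/\ forall x, `|F x v| <= C / (3 + `|x|) ^+ 2,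
      forall x y, `|F y v - F x v| <=
        C * `|y - x| / (3 + Num.max 0 (`|x| - `|y - x|)) ^+ 2,
      forall x, `|F x v - F x v'| <= C * `|v - v'| / (3 + `|x|) ^+ 2 &
      forall x y, `|(F y v - F y v') - (F x v - F x v')| <=
        C * `|v - v'| * `|y - x| / (3 + Num.max 0 (`|x| - `|y - x|)) ^+ 2].

Lemma Psi_conv alpha psi A x v : supported A psi ->
  Psi alpha psi x v = kconv A (fun r => pospow r (v - alpha^-1)) psi x.
Proof.
by move=> sA; apply: Rintegral_supported => s As; rewrite sA // mulr0.
Qed.

(** An increment in [v] is again a convolution of [psi] with a kernel of the same class, so the
    decay and Lipschitz lemmas, each used twice, give all four bounds. *)
Lemma Psi_estimates alpha psi v0 v1 : 1 < alpha -> alpha < 2 ->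
  C3 psi -> compact_support psi -> generates_ONB psi ->
  alpha^-1 < v0 -> v1 < 1 ->
  exists2 C, 0 < C & kernel_estimates (Psi alpha psi) v0 v1 C.
Proof.
move=> a1 a2 c3 cs onb av0 v11.
have [A [th1 [th2 [th3 [[A0 s0 s1 s2 s3] [d1 d2 d3]]]]]] :=
  wavelet_iterated_primitives c3 cs onb.
have [dpsi dpsi2 _] := C3_is_derive c3.
have cpsi : continuous psi by move=> x; exact: is_derive_continuous (dpsi x).
have cdpsi : continuous (derive1 psi) by move=> x; exact: is_derive_continuous (dpsi2 x).
have [C1 C10 dec] := conv_kernel_decay A0 dpsi cdpsi d1 d2 d3 s1 s2 s3.
have [C2 C20 lip] := conv_kernel_lipschitz A0 dpsi cdpsi d1 d2 d3 s0 s1 s2.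
have k0 : 0 < v0 - alpha^-1 by rewrite subr_gt0.
have ah : 2^-1 < alpha^-1 by rewrite ltf_pV2 ?posrE //; lra.
have [K K0 [ker dker]] := kernel_pospow A0 k0.
pose C := (C1 + C2) * K.
have C0 : 0 < C by rewrite mulr_gt0 // addr_gt0.
exists C => // v v' /andP[v0v vv1] /andP[v0v' v'v1].
set k := v - alpha^-1; set k' := v' - alpha^-1.
have kk : `|v - v'| = `|k - k'| by congr `|_|; rewrite /k /k'; ring.
have kerv := ker k; have kerd := dker k k'.
have kv : v0 - alpha^-1 <= k <= 1 / 2 by rewrite /k; apply/andP; lra.
have kv' : v0 - alpha^-1 <= k' <= 1 / 2 by rewrite /k'; apply/andP; lra.
have {}kerv := ker k kv; have {}kerd := dker k k' kv kv'.
have cpow w x s : v0 <= w -> {for s, continuous (fun s => pospow (x - s) (w - alpha^-1))}.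
  move=> v0w; apply: (@continuous_rsub R (fun r => pospow r (w - alpha^-1))).
  by apply: continuous_pospow; lra.
have D x : Psi alpha psi x v - Psi alpha psi x v' =
    kconv A (fun r => pospow r k - pospow r k') psi x.
  rewrite !(@Psi_conv _ _ A) // /kconv -RintegralB //.
  - by apply: eq_Rintegral => s _; rewrite mulrBl.
  - apply: continuous_on_integrable => s _; apply: continuousM; last exact: cpsi.
    exact: cpow.
  - apply: continuous_on_integrable => s _; apply: continuousM; last exact: cpsi.
    exact: cpow.
have dec' phi K' x : 0 <= K' -> smooth_kernel A (K * K') phi ->
    `|kconv A phi psi x| <= C * K' / (3 + `|x|) ^+ 2.
  move=> K'0 kphi; apply: le_trans (dec _ _ x kphi) _.
  rewrite ler_wpM2r ?invr_ge0 ?exprn_ge0 ?addr_ge0 // mulrA ler_wpM2r // /C.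
  by rewrite ler_wpM2r ?(ltW K0) // lerDl ltW.
have lip' phi K' x y : 0 <= K' -> smooth_kernel A (K * K') phi ->
    `|kconv A phi psi y - kconv A phi psi x| <=
    C * K' * `|y - x| / (3 + Num.max 0 (`|x| - `|y - x|)) ^+ 2.
  move=> K'0 kphi; set m := 3 + _.
  have m0 : 0 < m by rewrite ltr_pwDl // le_max lexx.
  have mz z : `|z - x| <= `|y - x| -> m <= 3 + `|z|.
    move=> zx; rewrite /m lerD2l ge_max normr_ge0 /=.
    have := ler_distD z x 0; rewrite !subr0 (distrC x z); lra.
  have CC : C2 * (K * K') <= C * K'.
    by rewrite mulrA ler_wpM2r // ler_wpM2r ?(ltW K0) // lerDr ltW.
  have mV : 0 <= (m ^+ 2)^-1 by rewrite invr_ge0 exprn_ge0 // ltW.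
  case: (leP x y) => xy.
    apply: le_trans (lip _ _ _ _ m kphi m0 xy _) _.
      move=> z /andP[xz zy]; apply: mz; rewrite !ger0_norm ?subr_ge0 //; lra.
    by rewrite ger0_norm ?subr_ge0 // ler_wpM2r // ler_wpM2r // subr_ge0.
  rewrite distrC; apply: le_trans (lip _ _ _ _ m kphi m0 (ltW xy) _) _.
    move=> z /andP[xz zy]; apply: mz; rewrite !ler0_norm ?subr_le0 ?(ltW xy) //; lra.
  rewrite (ler0_norm (_ : y - x <= 0)) ?subr_le0 ?(ltW xy) // opprB.
  by rewrite ler_wpM2r // ler_wpM2r // subr_ge0 ltW.
rewrite -[K]mulr1 in kerv; rewrite kk; split.
- by move=> x; rewrite (@Psi_conv _ _ A) // -[C]mulr1; exact: dec'.
- by move=> x y; rewrite !(@Psi_conv _ _ A) // -[C]mulr1; exact: lip'.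
- by move=> x; rewrite D; exact: dec'.
- by move=> x y; rewrite !D; exact: (lip' _ _ x y (normr_ge0 _) kerd).
Qed.

End PsiEstimates.

(** * Powers of 2 and summable weights *)

Section Terms.
Variable R : realType.
Implicit Types (x y z t s u v h k eta : R).

Lemma exp2D x y : (2 : R) `^ (x + y) = 2 `^ x * 2 `^ y.
Proof. by rewrite powRD // pnatr_eq0 implybT. Qed.

Lemma ler_exp2 x y : x <= y -> (2 : R) `^ x <= 2 `^ y.
Proof. by apply: ler_powR; rewrite ler1n. Qed.

Lemma exp2_ge0 x : 0 <= (2 : R) `^ x. Proof. exact: powR_ge0. Qed.

Lemma exp2_le1 x : x <= 0 -> (2 : R) `^ x <= 1.
Proof. by move=> /ler_exp2; rewrite powRr0. Qed.

(** The weight left for summation over [k]: its sum over integer translates is bounded uniformly by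
    [symsum_decay_le]. *)
Definition wt eta x : R := (3 + `|x|) `^ (- (1 + eta)).

Lemma wt_ge0 eta x : 0 <= wt eta x. Proof. exact: powR_ge0. Qed.

Lemma weight_ge1 x : 1 <= 3 + `|x|.
Proof. have := normr_ge0 x; lra. Qed.

Lemma powR_le_wt eta p x : p <= - (1 + eta) -> (3 + `|x|) `^ p <= wt eta x.
Proof. by move=> pe; apply: ler_powR => //; exact: weight_ge1. Qed.

Lemma weight_sqV x : ((3 + `|x|) ^+ 2)^-1 = (3 + `|x|) `^ (- 2).
Proof. by rewrite -powR_invn // addr_ge0. Qed.

(** [J] is [-log2 h] rounded to an integer, the scale where [2^j h] passes 1. Above it the left side
    decays like [2^(-jk)], below it like [2^(j(1-k))], both at rate at least [eta]. The factor 2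
    pays for the rounding, and no logarithm of [h] arises from the sum over [j]. *)
Lemma near_scale_bound h (eta k : R) : 0 < h -> eta <= k -> eta <= 1 - k -> 0 <= k <= 1 ->
  exists J : int, forall j : int,
    2 `^ (- (j%:~R * k)) * Num.min 1 (2 `^ j%:~R * h) <=
    2 * h `^ k * 2 `^ (- (eta * `|(j - J)%:~R|)).
Proof.
move=> h0 ek e1k /andP[k0 k1].
have l2 : 0 < ln (2 : R) by rewrite ln_gt0 // ltr1n.
pose th := ln h / ln 2.
have hE : h = 2 `^ th by rewrite powR_expR // /th divfK ?gt_eqF // lnK.
pose J := - Num.floor th; exists J => j.
have := floor_le th; have := floorD1_gt th; rewrite intrD.
have -> : (Num.floor th)%:~R = - J%:~R :> R by rewrite /J rmorphN /= opprK.
move=> thJ Jth; rewrite rmorphB /=.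
set m : R := j%:~R; set n : R := J%:~R; rewrite -/n in thJ Jth.
have -> : 2 * h `^ k * 2 `^ (- (eta * `|m - n|)) = 2 `^ (1 + th * k - eta * `|m - n|).
  by rewrite !exp2D powRr1 // powRrM -hE.
have [mn|mn] := leP n m.
  apply: (@le_trans _ _ (2 `^ (- (m * k)) * 1)).
    by rewrite ler_wpM2l ?exp2_ge0 // ge_min lexx.
  rewrite mulr1; apply: ler_exp2; rewrite ger0_norm ?subr_ge0 //.
  have p1 : 0 <= (k - eta) * (m - n) by rewrite mulr_ge0 ?subr_ge0.
  have p2 : 0 <= k * (th + n) by rewrite mulr_ge0 //; lra.
  nra.
apply: (@le_trans _ _ (2 `^ (- (m * k)) * (2 `^ m * h))).
  by rewrite ler_wpM2l ?exp2_ge0 // ge_min lexx orbT.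
rewrite {1}hE -!exp2D; apply: ler_exp2.
rewrite ltr0_norm ?subr_lt0 //.
have p1 : 0 <= (1 - k - eta) * (n - m) by rewrite mulr_ge0 ?subr_ge0 // ltW.
have p2 : 0 <= k * (th + n) by rewrite mulr_ge0 //; lra.
nra.
Qed.

Lemma exp2_lipschitz v v' (j v0 v1 : R) : v0 <= v <= v1 -> v0 <= v' <= v1 ->
  `|2 `^ (- j * v) - 2 `^ (- j * v')| <=
  `|v - v'| * `|j| * 2 `^ (if 0 <= j then - j * v0 else - j * v1).
Proof.
move=> /andP[v0v vv1] /andP[v0v' v'v1].
have l2 : 0 < ln (2 : R) by rewrite ln_gt0 // ltr1n.
have l21 : ln (2 : R) <= 1.
  by have := @le_ln1Dx R 1; have -> : 1 + 1 = 2 :> R by []; apply; lra.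
rewrite !powR_expR //; set w := if _ then _ else _.
have wP y : v0 <= y -> y <= v1 -> - j * y <= w.
  move=> v0y yv1; rewrite /w; case: (leP 0 j) => j0.
    by rewrite ler_wnM2l // oppr_le0.
  by rewrite ler_wpM2l // oppr_ge0 ltW.
apply: le_trans (@expR_lipschitz _ _ _ (w * ln 2) _ _) _.
- by rewrite ler_wpM2r ?(ltW l2) // wP.
- by rewrite ler_wpM2r ?(ltW l2) // wP.
rewrite ler_wpM2r ?expR_ge0 // -mulrBl -mulrBr !normrM normrN (ger0_norm (ltW l2)).
by rewrite (mulrC `|j|) ler_piMr // mulr_ge0.
Qed.

(** Turns the factor [|j|], produced by varying the exponent of [2^(-jv)], into one more loss
    [eta]. *)
Lemma normr_le_exp2 eta : 0 < eta -> exists2 C : R, 0 < C & forall j : R, `|j| <= C * 2 `^ (eta * `|j|).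
Proof.
move=> e0.
have l2 : 0 < ln (2 : R) by rewrite ln_gt0 // ltr1n.
have el : 0 < eta * ln 2 by rewrite mulr_gt0.
exists (eta * ln 2)^-1 => [|j]; first by rewrite invr_gt0.
rewrite -(ler_pM2l el) mulrA mulfV ?gt_eqF // mul1r powR_expR //.
have := expR_ge1Dx (eta * `|j| * ln 2); lra.
Qed.

End Terms.

(** * Bounds on the terms of the series *)

Section TermBounds.
Variable R : realType.
Implicit Types (x y t s u v h m q : R).

Lemma powR_dominate (p : R) a b : p <= 0 -> 0 < a -> a <= b -> b `^ p <= a `^ p :> R.
Proof.
move=> p0 a0 ab; have b0 : 0 < b by exact: lt_le_trans ab.
rewrite -[p]opprK (powRN b) (powRN a) lef_pV2 ?posrE ?powR_gt0 //.
by apply: ge0_ler_powR; rewrite ?nnegrE ?oppr_ge0 // ltW.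
Qed.

(** When the kernel weight [m] controls [3 + |k|] up to the factor [q], its square decay is
    converted into decay in [k] and absorbs the growth of the coefficient. *)
Lemma coef_far (E C0 eJ sg k Y Q B m q : R) : 0 <= Y -> 0 <= Q -> 0 <= B -> 0 < m -> 0 < q ->
  `|E| <= C0 * eJ * (3 + `|k|) `^ sg -> Y <= Q * (B / m ^+ 2) -> 3 + `|k| <= q * m ->
  `|E| * Y <= C0 * q ^+ 2 * (Q * B * eJ) * (3 + `|k|) `^ (sg - 2).
Proof.
move=> Y0 Q0 B0 m0 q0 EP YP kq; have D1 := weight_ge1 k.
set D := 3 + `|k| in EP kq D1 *; have D0 : 0 < D by lra.
have mD : (m ^+ 2)^-1 <= q ^+ 2 * (D ^+ 2)^-1.
  rewrite -[X in _ <= X]invrK lef_pV2 ?posrE ?exprn_gt0 ?invr_gt0 //; last first.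
    by rewrite mulr_gt0 ?invr_gt0 ?exprn_gt0.
  rewrite invfM invrK mulrC ler_pdivrMr ?exprn_gt0 // -exprMn mulrC.
  by apply: lerXn2r; rewrite ?nnegrE ?(ltW D0) // mulr_ge0 // ltW.
apply: le_trans (ler_pM (normr_ge0 _) Y0 EP YP) _.
have -> : D `^ (sg - 2) = D `^ sg * (D ^+ 2)^-1.
  by rewrite powRD ?(gt_eqF D0) ?implybT // -powR_invn // ltW.
have -> : C0 * q ^+ 2 * (Q * B * eJ) * (D `^ sg * (D ^+ 2)^-1) =
  C0 * eJ * D `^ sg * (Q * (B * (q ^+ 2 * (D ^+ 2)^-1))) by ring.
apply: ler_wpM2l; first exact: le_trans EP.
by apply: ler_wpM2l => //; apply: ler_wpM2l.
Qed.

(** The bounds at a fixed outcome. Polynomial growth in [j] is weakened to [2^(eta |j|)], so that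
    all losses in scale add up in one exponent of 2. *)
Definition coef_bounds (e : int -> int -> R) (ia eta l C0 C1 : R) :=
  (forall j k : int, `|e j k| <= C0 * 2 `^ (eta * `|j%:~R|) * (3 + `|k%:~R|) `^ (ia + eta)) /\
  (forall j k : int, 0 <= j -> `|k%:~R| * 2 `^ (- j%:~R) <= l -> `|e j k| <= C1 * 2 `^ (j%:~R * ia)).

(* [ia] stands for [1/alpha]; every loss in an exponent is a multiple of [eta]. *)
Definition admissible (ia v0 v1 eta : R) :=
  [/\ 0 < eta, 4 * eta <= v0 - ia, 4 * eta <= 1 - v1, 1 / 2 <= ia & v0 <= v1].

Lemma coef_bounds_ge0 e ia eta l C0 C1 : 0 <= l -> coef_bounds e ia eta l C0 C1 ->
  0 <= C0 /\ 0 <= C1.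
Proof.
move=> l0 [e0 e1]; split.
  have := le_trans (normr_ge0 _) (e0 0 0).
  by rewrite -mulrA pmulr_lge0 // mulr_gt0 ?powR_gt0 // ltr_pwDl.
have := le_trans (normr_ge0 _) (e1 0 0 (lexx _) _).
by rewrite normr0 mul0r => /(_ l0); rewrite pmulr_lge0 // powR_gt0.
Qed.

Lemma min_shift_bound (x p : R) : 0 <= p -> p <= 1 ->
  ((3 + Num.max 0 (`|x| - p)) ^+ 2)^-1 <= 3 * ((3 + `|x|) ^+ 2)^-1.
Proof.
move=> p0 p1; have x0 := normr_ge0 x.
set m := Num.max _ _; have m0 : 0 <= m by rewrite le_max lexx.
have mx : `|x| - p <= m by rewrite le_max lexx orbT.
rewrite -[X in _ <= X]invrK lef_pV2 ?posrE ?invr_gt0 ?mulr_gt0 ?invr_gt0 ?exprn_gt0 //; try lra.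
rewrite invfM invrK mulrC ler_pdivrMr //; nra.
Qed.

(** For [j < 0] the factor [2^j] from the increment outweighs [2^(-jv)] because [v < 1]; for distant
    [k] decay comes from [v > ia]. Only the near terms, where no loss is allowed, use the second
    coefficient bound. *)
Lemma increment_bound (F : R -> R -> R) e ia v0 v1 eta L C C0 C1 :
  admissible ia v0 v1 eta -> 1 <= L -> 0 < C ->
  kernel_estimates F v0 v1 C -> coef_bounds e ia eta (6 * L) C0 C1 ->
  exists2 M, 0 <= M & forall v t s (j k : int), v0 <= v <= v1 -> `|t| <= L -> `|s| <= L ->
  `|2 `^ (- j%:~R * v) * e j k *
      (F (2 `^ j%:~R * t - k%:~R) v - F (2 `^ j%:~R * s - k%:~R) v)| <=
  M * (2 `^ (- (j%:~R * (v - ia))) * Num.min 1 (2 `^ j%:~R * `|t - s|) *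
         (wt eta (2 `^ j%:~R * t - k%:~R) + wt eta (2 `^ j%:~R * s - k%:~R)) +
       `|t - s| * 2 `^ (- (eta * `|j%:~R|)) * wt eta (0 - k%:~R)).
Proof.
move=> [eta0 e0 e1 ia1 v01] L1 C_gt0 FE eb.
have [|C00 C10] := coef_bounds_ge0 _ eb; first lra.
have L0 : 0 <= L by lra.
have L30 : 0 < 1 + 3 * L by lra.
have C3C : C <= 3 * C by lra.
have eta2 : - 2 <= - (1 + eta) by lra.
have sgw : ia + eta - 2 <= - (1 + eta) by lra.
have [eb0 eb1] := eb.
have [M1 M1E] : {m | m = C0 * (1 + 3 * L) ^+ 2 * C} by eexists.
have [M2 M2E] : {m | m = C1 * (3 * C)} by eexists.
have [M3 M3E] : {m | m = C0 * 2 ^+ 2 * C} by eexists.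
have M10 : 0 <= M1 by rewrite M1E !mulr_ge0 ?exprn_ge0 ?(ltW C_gt0) //; lra.
have M20 : 0 <= M2 by rewrite M2E !mulr_ge0 ?(ltW C_gt0).
have M30 : 0 <= M3 by rewrite M3E !mulr_ge0 ?exprn_ge0 ?(ltW C_gt0).
exists (M1 + M2 + M3) => [|v t s j k vv tL sL]; first by rewrite !addr_ge0.
have [v0v vv1] : v0 <= v /\ v <= v1 by apply/andP.
have hneg : 0 <= 1 - v - 2 * eta by lra.
have hpos : 0 <= v - ia - 4 * eta by lra.
have hfar : ia + 2 * eta - 1 <= 0 by lra.
have [F1 F2 _ _] := FE v v vv vv.
set J : R := j%:~R; set K : R := k%:~R; set h := `|t - s|.
set x := 2 `^ J * s - K; set y := 2 `^ J * t - K.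
have J2 : 0 < (2 : R) `^ J by rewrite powR_gt0.
have h0 : 0 <= h by exact: normr_ge0.
have p0 : 0 <= 2 `^ J * h by rewrite mulr_ge0 // ltW.
have xyE : `|y - x| = 2 `^ J * h.
  rewrite /x /y (_ : 2 `^ J * t - K - (2 `^ J * s - K) = 2 `^ J * (t - s)); last by ring.
  by rewrite normrM gtr0_norm.
have hL : h <= 2 * L by apply: le_trans (ler_normB _ _) _; move: tL sL; clear; lra.
have xK : `|K| <= `|x| + 2 `^ J * L.
  have -> : K = 2 `^ J * s - x by rewrite /x; ring.
  apply: le_trans (ler_normB _ _) _; rewrite addrC lerD2l normrM gtr0_norm //.
  by rewrite ler_wpM2l // ltW.
set P1 := _ * Num.min _ _ * _; set P2 := _ * wt eta (0 - K).
have P10 : 0 <= P1.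
  by rewrite !mulr_ge0 ?exp2_ge0 ?addr_ge0 ?wt_ge0 // le_min ler01.
have P20 : 0 <= P2 by rewrite !mulr_ge0 ?exp2_ge0 ?wt_ge0.
have wtK : wt eta (0 - K) = (3 + `|K|) `^ (- (1 + eta)) by rewrite /wt sub0r normrN.
suff : [\/ `|2 `^ (- J * v) * e j k * (F y v - F x v)| <= M1 * P2,
  `|2 `^ (- J * v) * e j k * (F y v - F x v)| <= M2 * P1 |
  `|2 `^ (- J * v) * e j k * (F y v - F x v)| <= M3 * P2].
  case=> H; apply: le_trans H _.
  - by apply: ler_pM => //; [rewrite -addrA lerDl addr_ge0|rewrite lerDr].
  - by apply: ler_pM => //; [rewrite (addrC M1) -addrA lerDl addr_ge0|rewrite lerDl].
  - by apply: ler_pM => //; [rewrite lerDr addr_ge0|rewrite lerDr].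
have -> : `|2 `^ (- J * v) * e j k * (F y v - F x v)| =
    `|e j k| * (2 `^ (- J * v) * `|F y v - F x v|).
  by rewrite !normrM (ger0_norm (exp2_ge0 _)) mulrAC mulrC mulrA.
have Y0 : 0 <= 2 `^ (- J * v) * `|F y v - F x v| by rewrite mulr_ge0 ?exp2_ge0.
have far q : 0 < q -> 3 + `|K| <= q * (3 + Num.max 0 (`|x| - 2 `^ J * h)) ->
    `|e j k| * (2 `^ (- J * v) * `|F y v - F x v|) <=
    C0 * q ^+ 2 * C * (h * 2 `^ (- J * v + J + eta * `|J|)) * (3 + `|K|) `^ (ia + eta - 2).
  move=> q0 Kq.
  have -> : C0 * q ^+ 2 * C * (h * 2 `^ (- J * v + J + eta * `|J|)) =
      C0 * q ^+ 2 * (2 `^ (- J * v) * (C * (2 `^ J * h)) * 2 `^ (eta * `|J|)).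
    by rewrite !exp2D; ring.
  apply: (@coef_far _ _ _ _ _ _ _ _ (3 + Num.max 0 (`|x| - 2 `^ J * h))) => //.
  - by rewrite mulr_ge0 // ltW.
  - by rewrite ltr_pwDl // le_max lexx.
  - by apply: ler_wpM2l; [exact: exp2_ge0|have := F2 x y; rewrite xyE].
have [j0|j0] := ltP j 0.
  apply: Or31.
  have J0 : J <= 0 by rewrite lerz0 ltW.
  have J1 := exp2_le1 J0.
  have JL : 2 `^ J * L <= L by rewrite ler_piMl.
  have Jh : 2 `^ J * h <= 2 * L by apply: le_trans hL; rewrite ler_piMl.
  apply: le_trans (far (1 + 3 * L) _ _) _ => //.
    set mm := Num.max _ _; have m0 : 0 <= mm by rewrite le_max lexx.
    have mx : `|x| - 2 `^ J * h <= mm by rewrite le_max lexx orbT.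
    by move: L0 (mulr_ge0 L0 m0) mx xK JL Jh; clear; lra.
  rewrite -M1E /P2 wtK -!mulrA ler_wpM2l // ler_wpM2l //.
  apply: ler_pM; rewrite ?powR_ge0 //.
    apply: ler_exp2; rewrite (ler0_norm J0).
    by move: (mulr_le0_ge0 J0 hneg); clear; lra.
  by apply: ler_powR => //; exact: weight_ge1.
have J0 : 0 <= J by rewrite ler0z.
have [near|fark] := leP (`|K| * 2 `^ (- J)) (6 * L).
  apply: Or32; have ek := eb1 j k j0 near.
  have -> : M2 * P1 = C1 * 2 `^ (J * ia) * (2 `^ (- J * v) *
     (3 * C * Num.min 1 (2 `^ J * h) * (wt eta y + wt eta x))).
    rewrite /P1 M2E (_ : - (J * (v - ia)) = J * ia + - J * v); last by ring.
    by rewrite exp2D; ring.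
  apply: ler_pM => //; apply: ler_wpM2l; first exact: exp2_ge0.
  have w1 z : ((3 + `|z|) ^+ 2)^-1 <= wt eta z.
    by rewrite weight_sqV; exact: powR_le_wt.
  have D20 (z : R) : 0 <= ((3 + `|z|) ^+ 2)^-1 by rewrite invr_ge0 exprn_ge0 // addr_ge0.
  (* The two sides of the minimum: for a displacement of at least 1 both values are bounded by
     decay; for a smaller one the increment bound applies, and the shift in its weight costs the
     factor 3. *)
  have [p1|p1] := leP 1 (2 `^ J * h).
    rewrite mulr1; apply: le_trans (ler_normB _ _) _.
    apply: (@le_trans _ _ (C * (wt eta y + wt eta x))); last first.
      by apply: ler_wpM2r; rewrite ?addr_ge0 ?wt_ge0.
    rewrite mulrDr; apply: lerD.
      by apply: le_trans (F1 y) _; apply: ler_wpM2l; [exact: ltW|exact: w1].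
    by apply: le_trans (F1 x) _; apply: ler_wpM2l; [exact: ltW|exact: w1].
  have := F2 x y; rewrite xyE => H; apply: le_trans H _.
  have -> : 3 * C * (2 `^ J * h) * (wt eta y + wt eta x) =
     C * (2 `^ J * h) * (3 * (wt eta y + wt eta x)) by ring.
  apply: ler_wpM2l; first by rewrite mulr_ge0 // ltW.
  apply: le_trans (min_shift_bound x p0 (ltW p1)) _.
  by rewrite ler_wpM2l //; apply: le_trans (w1 x) _; rewrite lerDr wt_ge0.
apply: Or33.
(* Origin of [6 * L]: [|x|] falls short of [|K|] by at most [2^J L], and the displacement is at most
   [2 * 2^J L]; together this is less than half of [|K|], hence the ratio 2. *)
have {}fark : 6 * (2 `^ J * L) < `|K|.
  by move: fark; rewrite powRN ltr_pdivlMr //; clear; lra.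
have J2L : 2 `^ J <= 2 `^ J * L by rewrite ler_peMr // ltW.
have JhL : 2 `^ J * h <= 2 * (2 `^ J * L).
  by rewrite mulrCA ler_wpM2l // ltW.
apply: le_trans (far 2 _ _) _ => //.
  set mm := Num.max _ _.
  have mx : `|x| - 2 `^ J * h <= mm by rewrite le_max lexx orbT.
  by move: mx xK JhL fark; clear; lra.
rewrite -M3E /P2 wtK -!mulrA ler_wpM2l // ler_wpM2l //.
(* The summable weight is split off. The remaining exponent is nonpositive and the base exceeds
   [2^J], so it yields decay in the scale. The total is [J (ia - v + 3 eta)], at most [- eta J]
   because [4 eta <= v - ia]. *)
have -> : ia + eta - 2 = (ia + 2 * eta - 1) + - (1 + eta) by ring.
have D0 : 0 < 3 + `|K| by rewrite ltr_pwDl.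
rewrite powRD; last by rewrite (gt_eqF D0) implybT.
rewrite mulrA ler_wpM2r ?powR_ge0 //.
apply: (@le_trans _ _ (2 `^ (- J * v + J + eta * `|J|) * 2 `^ (J * (ia + 2 * eta - 1)))).
  rewrite ler_wpM2l ?exp2_ge0 // powRrM.
  apply: powR_dominate => //.
  by move: J2 J2L fark; clear; lra.
rewrite -exp2D; apply: ler_exp2; rewrite (ger0_norm J0).
by move: (mulr_ge0 J0 hpos); clear; lra.
Qed.

End TermBounds.

(** * Increments of the terms in the exponent *)

Section HurstBound.
Variable R : realType.
Implicit Types (x y t s u v h m q : R).

Lemma exp2_ge1 x : 0 <= x -> 1 <= (2 : R) `^ x.
Proof. by move=> /ler_exp2; rewrite powRr0. Qed.

Definition term (F : R -> R -> R) (e : int -> int -> R) v u (j k : int) : R :=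
  2 `^ (- j%:~R * v) * e j k * (F (2 `^ j%:~R * u - k%:~R) v - F (- k%:~R) v).

Lemma weight_transfer (a sg K y : R) : 0 <= sg -> 0 < a -> 3 + `|K| <= a * (3 + `|y|) ->
  (3 + `|K|) `^ sg * ((3 + `|y|) ^+ 2)^-1 <= a `^ sg * (3 + `|y|) `^ (sg - 2).
Proof.
move=> sg0 a0 Ky; have D1 := weight_ge1 y; have D2 := weight_ge1 K.
rewrite weight_sqV (powRD (s := - 2)); last by rewrite (gt_eqF (_ : 0 < 3 + `|y|)) ?implybT //; lra.
rewrite mulrA ler_wpM2r ?powR_ge0 // -powRM; [|lra|lra].
by apply: ge0_ler_powR; rewrite ?nnegrE ?mulr_ge0 ?addr_ge0 // ltW.
Qed.

(** For [j < 0] cancellation between the two values of [F] is needed: the increment in [x] brings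
    the factor [2^j], which beats [2^(-j v1)]. For [j >= 0] the two values are bounded separately,
    and transferring the weight from [k] to [2^j u - k] costs about [2^(j ia)], covered by
    [v0 > ia]. *)
Lemma hurst_bound (F : R -> R -> R) e ia v0 v1 eta L C C0 C1 :
  admissible ia v0 v1 eta -> 1 <= L -> 0 < C -> ia < 1 ->
  kernel_estimates F v0 v1 C -> coef_bounds e ia eta (6 * L) C0 C1 ->
  exists2 M, 0 <= M & forall v v' u (j k : int), v0 <= v <= v1 -> v0 <= v' <= v1 -> `|u| <= L ->
  `|term F e v u j k - term F e v' u j k| <=
  M * (`|v - v'| * 2 `^ (- (eta * `|j%:~R|)) *
        (wt eta (2 `^ j%:~R * u - k%:~R) + wt eta (0 - k%:~R))).
Proof.
move=> [eta0 e0 e1 ia1 v01] L1 C_gt0 ialt FE eb.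
have L0 : 0 <= L by lra.
have L10 : 0 < 1 + L by lra.
have sgw : ia + eta - 2 <= - (1 + eta) by lra.
have sg0 : 0 <= ia + eta by lra.
have sg1 : ia + eta <= 1 by lra.
have h3 : 0 <= 1 - v1 - 3 * eta by lra.
have h4 : 0 <= v0 - ia - 4 * eta by lra.
have [|C00 C10] := coef_bounds_ge0 _ eb; first lra.
have [eb0 _] := eb.
have [Ce Ce0 CeP] := normr_le_exp2 eta0.
have [M1 M1E] : {m | m = C0 * (1 + L) ^+ 2 * ((Ce + 1) * C * L)} by eexists.
have [M2 M2E] : {m | m = C0 * (Ce + 1) * C * (1 + L)} by eexists.
have M10 : 0 <= M1.
  by rewrite M1E !mulr_ge0 ?exprn_ge0 ?addr_ge0 ?(ltW C_gt0) ?(ltW Ce0) //; lra.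
have M20 : 0 <= M2.
  by rewrite M2E !mulr_ge0 ?exprn_ge0 ?addr_ge0 ?(ltW C_gt0) ?(ltW Ce0) //; lra.
exists (M1 + M2) => [|v v' u j k vv vv' uL]; first by rewrite !addr_ge0.
have [v0v' v'v1] : v0 <= v' /\ v' <= v1 by apply/andP.
have [_ F2 _ F4] := FE v v' vv vv'.
have [F1 _ F3 _] := FE v v' vv vv'.
rewrite /term; set J : R := j%:~R; set K : R := k%:~R; set d := `|v - v'|.
set y := 2 `^ J * u - K.
have d0 : 0 <= d by exact: normr_ge0.
have J2 : 0 < (2 : R) `^ J by rewrite powR_gt0.
have xyE : `|y - - K| = 2 `^ J * `|u|.
  by rewrite /y opprK subrK normrM gtr0_norm.
have uJ : 2 `^ J * `|u| <= 2 `^ J * L by rewrite ler_wpM2l // ltW.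
have uJ0 : 0 <= 2 `^ J * `|u| by rewrite mulr_ge0 // ltW.
set P := d * _ * _.
have P0 : 0 <= P by rewrite !mulr_ge0 ?exp2_ge0 ?addr_ge0 ?wt_ge0.
have wtK : wt eta (0 - K) = (3 + `|K|) `^ (- (1 + eta)) by rewrite /wt sub0r normrN.
set w : R := if 0 <= J then - J * v0 else - J * v1.
pose Q := d * (Ce + 1) * 2 `^ (eta * `|J| + w).
have Q0 : 0 <= Q by rewrite !mulr_ge0 ?exp2_ge0 ?addr_ge0 ?(ltW Ce0).
set X1 := F y v - F (- K) v; set X2 := F y v' - F (- K) v'.
set A1 := 2 `^ (- J * v); set A2 := 2 `^ (- J * v').
have J1 : 1 <= 2 `^ (eta * `|J|).
  by apply: exp2_ge1; rewrite mulr_ge0 // ltW.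
(* Product rule: one bound [G] serves both for the factor [F] and, multiplied by [d], for its
   increment in the exponent; the power of 2 contributes the constant [Ce]. *)
have Y G : 0 <= G -> `|X1| <= G -> `|X1 - X2| <= d * G ->
    `|A1 * e j k * X1 - A2 * e j k * X2| <= `|e j k| * (Q * G).
  move=> G0 X1G X2G.
  have -> : A1 * e j k * X1 - A2 * e j k * X2 =
    e j k * ((A1 - A2) * X1 + A2 * (X1 - X2)) by ring.
  rewrite normrM ler_wpM2l //.
  have -> : Q * G = d * (Ce * 2 `^ (eta * `|J|)) * 2 `^ w * G +
      2 `^ (eta * `|J|) * 2 `^ w * (d * G) by rewrite /Q exp2D; ring.
  apply: le_trans (ler_normD _ _) _; rewrite !normrM; apply: lerD; apply: ler_pM => //.
    apply: le_trans (exp2_lipschitz J vv vv') _; rewrite -/w ler_wpM2r ?exp2_ge0 //.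
    by rewrite ler_wpM2l.
  rewrite ger0_norm ?exp2_ge0 //; apply: (@le_trans _ _ (2 `^ w)).
    apply: ler_exp2; rewrite /w; case: (leP 0 J) => J0.
      by rewrite ler_wnM2l // oppr_le0.
    by rewrite ler_wpM2l // oppr_ge0 ltW.
  by rewrite ler_peMl ?exp2_ge0.
have X12 : X1 - X2 = F y v - F y v' - (F (- K) v - F (- K) v') by rewrite /X1 /X2; ring.
suff : `|A1 * e j k * X1 - A2 * e j k * X2| <= M1 * P \/
    `|A1 * e j k * X1 - A2 * e j k * X2| <= M2 * P.
  case=> H; apply: le_trans H _; apply: ler_wpM2r => //; [by rewrite lerDl|by rewrite lerDr].
have [j0|j0] := ltP j 0; [left|right].
  have J0 : J < 0 by rewrite ltrz0.
  have Jle1 := exp2_le1 (ltW J0).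
  have wE : w = - J * v1 by rewrite /w leNgt J0.
  have JL : 2 `^ J * L <= L by rewrite ler_piMl //; lra.
  set mm := 3 + Num.max 0 (`|K| - 2 `^ J * `|u|).
  have max0 : 0 <= Num.max 0 (`|K| - 2 `^ J * `|u|) by rewrite le_max lexx.
  have maxK : `|K| - 2 `^ J * `|u| <= Num.max 0 (`|K| - 2 `^ J * `|u|) by rewrite le_max lexx orbT.
  have m0 : 0 < mm by rewrite ltr_pwDl.
  have mV : 0 <= (mm ^+ 2)^-1 by rewrite invr_ge0 exprn_ge0 // ltW.
  have C2 : C * (2 `^ J * `|u|) <= C * (2 `^ J * L) by rewrite ler_wpM2l // ltW.
  have CL0 : 0 <= C * (2 `^ J * L) by apply: le_trans C2; rewrite mulr_ge0 // ltW.
  apply: le_trans (Y (C * (2 `^ J * L) / mm ^+ 2) _ _ _) _.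
  - by rewrite mulr_ge0.
  - by have := F2 (- K) y; rewrite xyE normrN => H; apply: le_trans H _; rewrite ler_wpM2r.
  - rewrite X12; have := F4 (- K) y; rewrite xyE normrN => H; apply: le_trans H _.
    have -> : d * (C * (2 `^ J * L) / mm ^+ 2) = C * d * (2 `^ J * L) / mm ^+ 2 by ring.
    by rewrite ler_wpM2r // ler_wpM2l // mulr_ge0 // ltW.
  apply: le_trans (@coef_far R _ C0 (2 `^ (eta * `|J|)) (ia + eta) K _ Q _ mm (1 + L)
    _ Q0 CL0 m0 _ _ (lexx _) _) _ => //.
  - by apply: mulr_ge0 => //; apply: mulr_ge0.
  - have Lmax := mulr_ge0 L0 max0.
    by move: L0 Lmax maxK (le_trans uJ JL); rewrite /mm; clear; lra.
  have -> : C0 * (1 + L) ^+ 2 * (Q * (C * (2 `^ J * L)) * 2 `^ (eta * `|J|)) =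
      M1 * (d * 2 `^ (eta * `|J| + w + J + eta * `|J|)).
    by rewrite M1E /Q !exp2D; ring.
  rewrite -mulrA ler_wpM2l // /P; apply: ler_pM; rewrite ?powR_ge0 ?mulr_ge0 ?exp2_ge0 //.
    rewrite ler_wpM2l //; apply: ler_exp2; rewrite wE (ltr0_norm J0).
    have : J * (1 - v1 - 3 * eta) <= 0 by rewrite nmulr_rle0.
    by clear; lra.
  apply: (@le_trans _ _ (wt eta (0 - K))); last by rewrite lerDr wt_ge0.
  by rewrite wtK; apply: ler_powR => //; exact: weight_ge1.
have J0 : 0 <= J by rewrite ler0z.
have wE : w = - J * v0 by rewrite /w J0.
have J21 : 1 <= (2 : R) `^ J by exact: exp2_ge1.
have D20 (z : R) : 0 <= ((3 + `|z|) ^+ 2)^-1 by rewrite invr_ge0 exprn_ge0 // addr_ge0.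
apply: le_trans (Y (C * (((3 + `|y|) ^+ 2)^-1 + ((3 + `|K|) ^+ 2)^-1)) _ _ _) _.
- by rewrite mulr_ge0 ?addr_ge0 // ltW.
- apply: le_trans (ler_normB _ _) _; rewrite mulrDr; apply: lerD; first exact: F1.
  by have := F1 (- K); rewrite normrN.
- rewrite X12; apply: le_trans (ler_normB _ _) _; rewrite !mulrDr; apply: lerD.
    by apply: le_trans (F3 y) _; rewrite mulrA (mulrC d).
  by have := F3 (- K); rewrite normrN => H; apply: le_trans H _; rewrite mulrA (mulrC d).
set sg := ia + eta; rewrite -/sg in sg0 sg1 sgw.
(* Applied both to [y] and to [K] itself, the two points whose weights appear in the final bound. *)
have tr z : 3 + `|K| <= 2 `^ J * (1 + L) * (3 + `|z|) ->
    (3 + `|K|) `^ sg * ((3 + `|z|) ^+ 2)^-1 <= 2 `^ (J * sg) * (1 + L) * wt eta z.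
  move=> Kz; apply: le_trans (weight_transfer sg0 _ Kz) _; first by rewrite mulr_gt0.
  apply: ler_pM; rewrite ?powR_ge0 //; last exact: powR_le_wt.
  rewrite powRM ?exp2_ge0 ?(ltW L10) // -powRrM ler_wpM2l ?exp2_ge0 //.
  by apply: ler1_powR => //; rewrite lerDl.
have trK : (3 + `|K|) `^ sg * ((3 + `|K|) ^+ 2)^-1 <= 2 `^ (J * sg) * (1 + L) * wt eta (0 - K).
  rewrite -[wt _ _]/((3 + `|0 - K|) `^ _) sub0r normrN; apply: tr.
  rewrite ler_peMl ?addr_ge0 //; apply: (@le_trans _ _ (1 * 1)); first by rewrite mulr1.
  by apply: ler_pM => //; rewrite lerDl.
have try : (3 + `|K|) `^ sg * ((3 + `|y|) ^+ 2)^-1 <= 2 `^ (J * sg) * (1 + L) * wt eta y.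
  apply: tr.
  have KyL : `|K| <= `|y| + 2 `^ J * L.
    have -> : K = 2 `^ J * u - y by rewrite /y; ring.
    by apply: le_trans (ler_normB _ _) _; rewrite addrC lerD2l normrM gtr0_norm.
  have y0 := normr_ge0 y.
  have p1 : 0 <= (2 `^ J - 1) * (3 + `|y|) by rewrite mulr_ge0 ?subr_ge0 ?addr_ge0.
  have p2 : 0 <= 2 `^ J * L * (2 + `|y|) by rewrite !mulr_ge0 ?exp2_ge0 ?addr_ge0.
  have -> : 2 `^ J * (1 + L) * (3 + `|y|) = (2 `^ J - 1) * (3 + `|y|) + (3 + `|y|) +
    2 `^ J * L * (2 + `|y|) + 2 `^ J * L by ring.
  by move: KyL p1 p2; clear; lra.
apply: (@le_trans _ _ (C0 * 2 `^ (eta * `|J|) * (3 + `|K|) `^ sg *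
    (Q * (C * (((3 + `|y|) ^+ 2)^-1 + ((3 + `|K|) ^+ 2)^-1))))).
  apply: ler_wpM2r; last exact: eb0.
  by apply: mulr_ge0 => //; apply: mulr_ge0; [exact: ltW|exact: addr_ge0].
have -> : C0 * 2 `^ (eta * `|J|) * (3 + `|K|) `^ sg *
    (Q * (C * (((3 + `|y|) ^+ 2)^-1 + ((3 + `|K|) ^+ 2)^-1))) =
  C0 * 2 `^ (eta * `|J|) * Q * C *
    ((3 + `|K|) `^ sg * ((3 + `|y|) ^+ 2)^-1 + (3 + `|K|) `^ sg * ((3 + `|K|) ^+ 2)^-1) by ring.
apply: (@le_trans _ _ (C0 * 2 `^ (eta * `|J|) * Q * C *
    (2 `^ (J * sg) * (1 + L) * wt eta y + 2 `^ (J * sg) * (1 + L) * wt eta (0 - K)))).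
  apply: ler_wpM2l; last exact: lerD.
  apply: mulr_ge0; last exact: ltW.
  by apply: mulr_ge0 => //; apply: mulr_ge0 => //; exact: exp2_ge0.
have -> : C0 * 2 `^ (eta * `|J|) * Q * C *
    (2 `^ (J * sg) * (1 + L) * wt eta y + 2 `^ (J * sg) * (1 + L) * wt eta (0 - K)) =
  M2 * (d * 2 `^ (eta * `|J| + w + J * sg + eta * `|J|) * (wt eta y + wt eta (0 - K))).
  by rewrite M2E /Q !exp2D; ring.
rewrite ler_wpM2l // /P ler_wpM2r ?addr_ge0 ?wt_ge0 // ler_wpM2l //; apply: ler_exp2.
rewrite wE (ger0_norm J0) /sg.
have : 0 <= J * (v0 - ia - 4 * eta) by rewrite mulr_ge0.
by clear; lra.
Qed.

End HurstBound.

(** * Bounds on the series *)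

Section SeriesBounds.
Variable R : realType.
Implicit Types (t s u v : R).

(** On a bounded range of [h] an exponent may be lowered; a gap of at most 1 keeps the cost to one
    factor [B]. *)
Lemma powR_le_scaled (h B p q : R) : 0 < h -> h <= B -> 1 <= B -> q <= p -> p <= q + 1 ->
  h `^ p <= B * h `^ q.
Proof.
move=> h0 hB B1 qp pq; have -> : p = (p - q) + q by ring.
rewrite powRD ?(gt_eqF h0) ?implybT // ler_wpM2r ?powR_ge0 //.
apply: (@le_trans _ _ (B `^ (p - q))).
  by apply: ge0_ler_powR; rewrite ?nnegrE ?subr_ge0 ?(ltW h0) //; lra.
by apply: ler1_powR; lra.
Qed.

(** [S] bounds sums over [k] uniformly in the centre, [G] sums over [j] uniformly in the critical
    scale. The near part then gives the power of [|t - s|] directly, and the [O(|t - s|)] part is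
    absorbed since the exponent is at most 1. *)
Lemma sqsum_increment_le (F : R -> R -> R) e ia v0 v1 eta L C C0 C1 :
  admissible ia v0 v1 eta -> 1 <= L -> 0 < C ->
  kernel_estimates F v0 v1 C -> coef_bounds e ia eta (6 * L) C0 C1 ->
  exists2 M, 0 <= M & forall v t s N, v0 <= v <= v1 -> `|t| <= L -> `|s| <= L -> t != s ->
  sqsum (fun j k => `|2 `^ (- j%:~R * v) * e j k *
      (F (2 `^ j%:~R * t - k%:~R) v - F (2 `^ j%:~R * s - k%:~R) v)|) N <=
  M * `|t - s| `^ (v - ia).
Proof.
move=> adm L1 C_gt0 FE eb; have [M0 M00 MP] := increment_bound adm L1 C_gt0 FE eb.
have [eta0 e0 e1 ia1 v01] := adm.
have [S SE] : {m : R | m = eta^-1 + eta^-1} by eexists.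
have S0 : 0 <= S by rewrite SE addr_ge0 // invr_ge0 ltW.
have [G GE] : {m : R | m = (1 - 2 `^ (- eta))^-1 + (1 - 2 `^ (- eta))^-1} by eexists.
have sG p N := symsum_exp2_le p N eta0; rewrite -GE in sG.
have G0 : 0 <= G by apply: le_trans (sG 0 0%N); apply: symsum_ge0 => j; exact: exp2_ge0.
have sS x N : symsum (fun k => wt eta (x - k%:~R)) N <= S.
  by rewrite SE; exact: symsum_decay_le.
exists (M0 * ((S + S) * (2 * G) + S * (2 * L + 1) * G)).
  by rewrite mulr_ge0 // addr_ge0 // !mulr_ge0 // addr_ge0 // mulr_ge0 //; lra.
move=> v t s N /andP[v0v vv1] tL sL ts.
have k1 : eta <= v - ia by lra.
have k2 : eta <= 1 - (v - ia) by lra.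
have k3 : 0 <= v - ia <= 1 by apply/andP; lra.
have h0 : 0 < `|t - s| by rewrite normr_gt0 subr_eq0.
have hL : `|t - s| <= 2 * L + 1 by apply: le_trans (ler_normB _ _) _; lra.
have [J JP] := near_scale_bound h0 k1 k2 k3.
set h := `|t - s| in h0 hL JP *; set kap := v - ia in k1 k2 k3 JP *.
pose near (j : int) : R := 2 `^ (- (j%:~R * kap)) * Num.min 1 (2 `^ j%:~R * h).
pose g (j : int) : R := 2 `^ (- (eta * `|j%:~R|)).
have near0 j : 0 <= near j.
  by rewrite mulr_ge0 ?exp2_ge0 // le_min ler01 mulr_ge0 ?exp2_ge0 // ltW.
have g0 j : 0 <= h * g j by rewrite mulr_ge0 ?exp2_ge0 // ltW.
apply: (@sqsum_le_rows _ _ (fun j => M0 * ((S + S) * near j + (S * h) * g j))).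
  move=> j n; set A := 2 `^ j%:~R * t; set B := 2 `^ j%:~R * s.
  apply: (@le_trans _ _ (symsum (fun k => M0 * (near j * (wt eta (A - k%:~R) +
      wt eta (B - k%:~R)) + h * g j * wt eta (0 - k%:~R))) n)).
    by apply: symsum_le => k; apply: MP => //; rewrite v0v.
  rewrite symsumZ symsumD !symsumZ symsumD ler_wpM2l //.
  have -> : (S + S) * near j + S * h * g j = near j * (S + S) + h * g j * S by ring.
  by apply: lerD; apply: ler_wpM2l => //; apply: lerD.
rewrite symsumZ symsumD !symsumZ.
rewrite (_ : M0 * _ * _ = M0 * ((S + S) * (2 * G) * h `^ kap + S * (2 * L + 1) * G * h `^ kap));
  last by ring.
apply: ler_wpM2l => //.
have hk : h <= (2 * L + 1) * h `^ kap.
  rewrite -[X in X <= _](powRr1 (ltW h0)).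
  by move/andP: k3 => [k30 k31]; apply: powR_le_scaled => //; lra.
apply: lerD.
  rewrite -!mulrA ler_wpM2l ?addr_ge0 //.
  apply: (@le_trans _ _ (symsum (fun j => 2 * h `^ kap * 2 `^ (- (eta * `|(j - J)%:~R|))) N)).
    by apply: symsum_le => j; exact: JP.
  by rewrite symsumZ -mulrA ler_wpM2l // mulrC ler_wpM2r ?powR_ge0.
have -> : S * (2 * L + 1) * G * h `^ kap = S * ((2 * L + 1) * h `^ kap) * G by ring.
apply: ler_pM => //.
- by rewrite mulr_ge0 // ltW.
- by apply: symsum_ge0 => j; exact: exp2_ge0.
- by rewrite ler_wpM2l.
- apply: le_trans (sG 0 N); apply: symsum_le => j; by rewrite subr0.
Qed.

Lemma sqsum_hurst_le (F : R -> R -> R) e ia v0 v1 eta L C C0 C1 :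
  admissible ia v0 v1 eta -> 1 <= L -> 0 < C -> ia < 1 ->
  kernel_estimates F v0 v1 C -> coef_bounds e ia eta (6 * L) C0 C1 ->
  exists2 M, 0 <= M & forall v v' u N, v0 <= v <= v1 -> v0 <= v' <= v1 -> `|u| <= L ->
  sqsum (fun j k => `|term F e v u j k - term F e v' u j k|) N <= M * `|v - v'|.
Proof.
move=> adm L1 C_gt0 ia_lt1 FE eb; have [M0 M00 MP] := hurst_bound adm L1 C_gt0 ia_lt1 FE eb.
have [eta0 e0 e1 ia1 v01] := adm.
have [S SE] : {m : R | m = eta^-1 + eta^-1} by eexists.
have S0 : 0 <= S by rewrite SE addr_ge0 // invr_ge0 ltW.
have [G GE] : {m : R | m = (1 - 2 `^ (- eta))^-1 + (1 - 2 `^ (- eta))^-1} by eexists.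
have sG p N := symsum_exp2_le p N eta0; rewrite -GE in sG.
have G0 : 0 <= G by apply: le_trans (sG 0 0%N); apply: symsum_ge0 => j; exact: exp2_ge0.
have sS x N : symsum (fun k => wt eta (x - k%:~R)) N <= S.
  by rewrite SE; exact: symsum_decay_le.
exists (M0 * ((S + S) * G)); first by rewrite !mulr_ge0 // addr_ge0.
move=> v v' u N vv vv' uL; set d := `|v - v'|.
have d0 : 0 <= d by exact: normr_ge0.
pose g (j : int) : R := 2 `^ (- (eta * `|j%:~R|)).
apply: (@sqsum_le_rows _ _ (fun j => M0 * (d * (S + S)) * g j)).
  move=> j n; set A := 2 `^ j%:~R * u.
  apply: (@le_trans _ _ (symsum (fun k => M0 * (d * g j * (wt eta (A - k%:~R) +
      wt eta (0 - k%:~R)))) n)).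
    by apply: symsum_le => k; exact: MP.
  rewrite symsumZ symsumZ symsumD -mulrA ler_wpM2l //.
  have -> : d * (S + S) * g j = d * g j * (S + S) by ring.
  by apply: ler_wpM2l; [rewrite mulr_ge0 ?exp2_ge0|apply: lerD].
rewrite symsumZ (_ : M0 * ((S + S) * G) * d = M0 * (d * (S + S)) * G); last by ring.
apply: ler_wpM2l; first by rewrite !mulr_ge0 // addr_ge0.
apply: le_trans (sG 0 N); apply: symsum_le => j; by rewrite subr0.
Qed.

Lemma term_increment (F : R -> R -> R) e v t s j k :
  term F e v t j k - term F e v s j k = 2 `^ (- j%:~R * v) * e j k *
      (F (2 `^ j%:~R * t - k%:~R) v - F (2 `^ j%:~R * s - k%:~R) v).
Proof. by rewrite /term; ring. Qed.

Lemma term0 (F : R -> R -> R) e v j k : term F e v 0 j k = 0.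
Proof. by rewrite /term mulr0 sub0r subrr mulr0. Qed.

(* Summability of the terms themselves is the case [s = 0] of the increment bound. *)
Lemma is_cvg_sqsum_term (F : R -> R -> R) e v L B :
  (forall t N, `|t| <= L -> t != 0 -> sqsum (fun j k => `|2 `^ (- j%:~R * v) * e j k *
      (F (2 `^ j%:~R * t - k%:~R) v - F (2 `^ j%:~R * 0 - k%:~R) v)|) N <= B t) ->
  forall u, `|u| <= L -> cvgn (sqsum (term F e v u)).
Proof.
move=> FB u uL; have [->|u0] := eqVneq u 0.
  apply: (@is_cvg_sqsum _ _ 0) => N; rewrite /sqsum /symsum.
  rewrite big1 // => i _; rewrite big1 // => l _; by rewrite term0 normr0.
apply: (@is_cvg_sqsum _ _ (B u)) => N; apply: le_trans (FB u N uL u0).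
by apply: sqsum_le => j k; rewrite -term_increment term0 subr0.
Qed.

(** As [ia + eta <= 1], the power of [3 + |j|] is at most [3 + |j|], and this is at most
    [(3 + Ce) 2^(eta |j|)]. *)
Lemma coef_bounds_of_omega (e : int -> int -> R) (ia eta l c0 c1 : R) : 0 < eta ->
  0 <= ia + eta <= 1 -> 0 <= c0 ->
  (forall j k : int, `|e j k| <= c0 * (3 + `|j%:~R : R|) `^ (ia + eta)
                           * (3 + `|k%:~R : R|) `^ (ia + eta)) ->
  (forall j k : int, 0 <= j -> `|k%:~R : R| * 2 `^ (- j%:~R) <= l ->
     `|e j k| <= c1 * 2 `^ (j%:~R * ia)) ->
  exists C0 C1, coef_bounds e ia eta l C0 C1.
Proof.
move=> eta0 /andP[sg0 sg1] c00 e0 e1; have [Ce Ce0 CeP] := normr_le_exp2 eta0.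
exists (c0 * (3 + Ce)), c1; split=> // j k; apply: le_trans (e0 j k) _.
rewrite ler_wpM2r ?powR_ge0 // -mulrA ler_wpM2l //.
apply: le_trans (ler1_powR _ sg1) _; first exact: weight_ge1.
rewrite mulrDl; apply: lerD; last exact: CeP.
by rewrite ler_peMr // exp2_ge1 // mulr_ge0 // ltW.
Qed.

End SeriesBounds.

(** * Assembly of the two increments *)

Unset Implicit Arguments.
Set Strict Implicit.

Theorem mainTheorem1 (R : realType) (d : measure_display) (Omega : measurableType d)
  (P : probability Omega R) (alpha : R) (psi : R -> R)
  (IZ : (R -> R) -> Omega -> R) (H : R -> R) (a b gammaH minH : R)
  (O0 O1 : set Omega) :
  1 < alpha -> alpha < 2 ->
  SaS_integral P alpha IZ ->
  C3 psi -> compact_support psi -> generates_ONB psi ->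
  continuous H -> (forall x, alpha^-1 < H x < 1) ->
  a <= b ->
  (forall x, x \in `[a, b] -> alpha^-1 < H x < 1) ->
  0 <= gammaH -> gammaH < 1 -> Holder_on a b gammaH H ->
  (exists2 x0, x0 \in `[a, b] & H x0 = minH) ->
  (forall x, x \in `[a, b] -> minH <= H x) ->
  Omega0_prop P alpha (eps alpha psi IZ) O0 ->
  Omega1_prop P alpha (eps alpha psi IZ) O1 ->
  forall w, (O0 `&` O1) w ->
  exists M : R, forall t s, t \in `[a, b] -> s \in `[a, b] -> t != s ->
    `|LMSM alpha psi IZ H t w - LMSM alpha psi IZ H s w|
      <= M * `|t - s| `^ (Num.min gammaH (minH - alpha^-1)).
Proof.
move=> a1 a2 _ c3 cs onb cH H01 ab _ gH0 gH1 [_ [cHol HHol]] [x0 x0ab Hx0] minHP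
  [_ [_ om0]] [_ [_ om1]] w [wO0 wO1].
have [|x1 x1ab maxH] := @EVT_max R H a b ab.
  by apply: continuous_on_within => x _; exact: cH.
set ia := alpha^-1; set v0 := minH; set v1 := H x1.
have iav0 : ia < v0 by rewrite /v0 -Hx0; have /andP[] := H01 x0.
have v11 : v1 < 1 by have /andP[] := H01 x1.
have v01 : v0 <= v1 by exact: minHP.
have ia12 : 1 / 2 <= ia.
  by rewrite mul1r lef_pV2 ?posrE //; lra.
(* A quarter of the margin, since the worst terms lose [3 eta] and must keep [eta] for summation
   over [j]. The margin is positive because the maximum [v1] of [H] is attained. *)
pose eta := Num.min (v0 - ia) (1 - v1) / 4.
have [m0 [m1 m2]] : 0 < Num.min (v0 - ia) (1 - v1) /\
    Num.min (v0 - ia) (1 - v1) <= v0 - ia /\ Num.min (v0 - ia) (1 - v1) <= 1 - v1.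
  by rewrite lt_min !ge_min !lexx orbT !subr_gt0 iav0 v11.
have adm : admissible ia v0 v1 eta by rewrite /eta; split; lra.
have eta0 : 0 < eta by case: adm.
pose L := `|a| + `|b| + 1.
have L1 : 1 <= L by rewrite lerDr addr_ge0.
have inL x : x \in `[a, b] -> `|x| <= L.
  rewrite in_itv /= => /andP[ax xb]; rewrite ler_norml /L.
  have := ler_norm (- a); have := ler_norm b; rewrite normrN.
  have := normr_ge0 a; have := normr_ge0 b; move=> ????; apply/andP; lra.
have Hin x : x \in `[a, b] -> v0 <= H x <= v1.
  by move=> xab; rewrite minHP // maxH.
have [c0 [_ [c0P e0]]] := om0 eta eta0.
have l0 : 0 < 6 * L by lra.
have [c1 [_ [_ e1]]] := om1 (6 * L) l0.
pose e j k := eps alpha psi IZ j k w.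
have sg : 0 <= ia + eta <= 1 by apply/andP; case: adm => ? ? ? ? ?; lra.
have [C0 [C1 eb]] := coef_bounds_of_omega (e := e) eta0 sg (ltW (c0P w)) (e0 w wO0) (e1 w wO1).
have [C C_gt0 FE] := Psi_estimates a1 a2 c3 cs onb iav0 v11.
have [M1 M10 M1P] := sqsum_increment_le adm L1 C_gt0 FE eb.
have ia_lt1 : ia < 1 by lra.
have [M2 M20 M2P] := sqsum_hurst_le adm L1 C_gt0 ia_lt1 FE eb.
pose X v u := limn (sqsum (term (Psi alpha psi) e v u)).
have XE u : LMSM alpha psi IZ H u w = X (H u) u by [].
have cX v u : v0 <= v <= v1 -> `|u| <= L -> cvgn (sqsum (term (Psi alpha psi) e v u)).
  move=> vv; apply: (@is_cvg_sqsum_term _ _ _ _ _ (fun t => M1 * `|t - 0| `^ (v - ia))).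
  by move=> t N tL t0; apply: M1P => //; rewrite normr0; lra.
pose g := Num.min gammaH (v0 - ia).
have [B BE] : {B | B = 2 * L} by eexists.
(* The Hölder constant [cHol] may be negative, hence its absolute value. [B = 2 * L] bounds
   [|t - s|] and is at least 1. *)
exists (M1 * B + M2 * (`|cHol| * B)) => t s tab sab ts.
rewrite !XE.
have [Ht Hs tL sL] := And4 (Hin t tab) (Hin s sab) (inL t tab) (inL s sab).
have h0 : 0 < `|t - s| by rewrite normr_gt0 subr_eq0.
have hB : `|t - s| <= B by apply: le_trans (ler_normB _ _) _; rewrite BE; move: tL sL; clear; lra.
have B1 : 1 <= B by rewrite BE; move: L1; clear; lra.
have [Ht0 Ht1] : v0 <= H t /\ H t <= v1 by apply/andP.
have [gg gv] : g <= gammaH /\ g <= v0 - ia by rewrite !ge_min !lexx orbT.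
have g0 : 0 <= g by rewrite le_min gH0 subr_ge0 ltW.
(* Both exponents at hand, [H t - ia] and [gammaH], lie between [g] and [g + 1], the range where
   [powR_le_scaled] lowers them to [g]. *)
have q1 : g <= H t - ia by apply: le_trans gv _; rewrite lerD2r.
have q2 : H t - ia <= g + 1 by move: Ht1 v11 ia12 g0; clear; lra.
have q3 : gammaH <= g + 1 by move: gH1 g0; clear; lra.
have d1 : `|X (H t) t - X (H t) s| <= M1 * `|t - s| `^ (H t - ia).
  apply: ler_norm_limB_sqsum; [exact: cX|exact: cX|] => N.
  apply: le_trans (M1P (H t) t s N Ht tL sL ts); apply: sqsum_le => j k.
  by rewrite term_increment.
have d2 : `|X (H t) s - X (H s) s| <= M2 * `|H t - H s|.
  by apply: ler_norm_limB_sqsum; [exact: cX|exact: cX|] => N; exact: M2P.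
apply: le_trans (ler_distD (X (H t) s) _ _) _; rewrite -/v0 -/ia -/g mulrDl; apply: lerD.
  apply: le_trans d1 _; rewrite -mulrA ler_wpM2l //.
  exact: (powR_le_scaled h0 hB B1 q1 q2).
apply: le_trans d2 _; rewrite -!mulrA ler_wpM2l //.
apply: le_trans (HHol t s tab sab ts) _.
apply: (@le_trans _ _ (`|cHol| * `|t - s| `^ gammaH)).
  by rewrite ler_wpM2r ?powR_ge0 // ler_norm.
rewrite ler_wpM2l //; exact: (powR_le_scaled h0 hB B1 gg q3).
Qed.
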